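(* Let $n\ge2$, $s=n-1$, $T=\{1,\dots,n-1\}$, $S=\{n\}$, and let $sl(n,\mathbb C)$ act on $\mathcal B=\mathbb C[x_1,\dots,x_n,y_1,\dots,y_n]$ by the representation attached to $(S,T)$ described in the context. Let $$\Delta=\partial_{x_n}\partial_{y_n}-\sum_{i=1}^{n-1}x_i\partial_{y_i},\qquad\eta=x_ny_n+\sum_{i=1}^{n-1}y_i\partial_{x_i},$$ and $\mathcal H_{l_1,l_2}=\{f\in\mathcal B_{l_1,l_2}\mid\Delta(f)=0\}$ for $l_1\in\mathbb Z$, $l_2\in\mathbb N$. If $l_1+l_2\le0$ or $l_1>0$, then $$\mathcal B_{l_1,l_2}=\mathcal H_{l_1,l_2}\oplus\eta\mathcal B_{l_1-1,l_2-1},$$ and $\mathcal H_{l_1,l_2}$ is an irreducible highest weight module. When $l_1+l_2\le0$, its highest weight is $-l_1\lambda_{n-2}+(l_1+l_2-1)\lambda_{n-1}$ and a corresponding highest weight vector is $x_s^{-l_1}y_n^{l_2}$. When $l_1>0$, its highest weight is $l_2\lambda_{n-2}-(l_1+l_2+1)\lambda_{n-1}$ and a corresponding highest weight vector is $\sum_{t=0}^{l_2}\frac{l_1!\,l_2!}{t!\,(l_1+t)!\,(l_2-t)!}x_s^tx_n^{l_1+t}y_s^{l_2-t}y_n^t$. Moreover, the set of polynomials $$\sum_{r_1,\dots,r_{n-1}=0}^\infty\frac{\alpha_n!\,\beta_n!\prod_{i=1}^{n-1}\binom{\beta_i}{r_i}\,(r_1+\cdots+r_{n-1})!}{(\alpha_n+r_1+\cdots+r_{n-1})!\,(\beta_n+r_1+\cdots+r_{n-1})!}\,x_n^{\alpha_n+r_1+\cdots+r_{n-1}}y_n^{\beta_n+r_1+\cdots+r_{n-1}}\prod_{i=1}^{n-1}x_i^{\alpha_i+r_i}y_i^{\beta_i-r_i},$$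 where $\alpha_1,\dots,\alpha_n,\beta_1,\dots,\beta_n\in\mathbb N$, $\alpha_n\beta_n=0$, $\alpha_n-\sum_{i=1}^{n-1}\alpha_i=l_1$ and $\sum_{i=1}^n\beta_i=l_2$, forms a basis of $\mathcal H_{l_1,l_2}$.
   Context: $\mathbb N$ denotes the nonnegative integers; $E_{i,j}$ are matrix units of size $n$; $\binom ar=0$ for $r>a$. $sl(n,\mathbb C)$ has Cartan subalgebra $H=\sum_{i=1}^{n-1}\mathbb C(E_{i,i}-E_{i+1,i+1})$, positive root vectors $E_{i,j}$ ($1\le i<j\le n$) spanning $\mathcal G_+$, and fundamental weights $\lambda_i$ with $\lambda_i(E_{j,j}-E_{j+1,j+1})=\delta_{i,j}$; $\lambda_0=0$. For a partition $(S,T)$ of $\{1,\dots,n\}$, $sl(n,\mathbb C)$ acts on $\mathcal B$ by (the restriction of): $E_{i,j}=x_i\partial_{x_j}-y_j\partial_{y_i}$ if $i,j\in S$; $-x_ix_j-y_j\partial_{y_i}$ if $i\in S,j\in T$; $\partial_{x_i}\partial_{x_j}-y_j\partial_{y_i}$ if $i\in T,j\in S$; $-x_j\partial_{x_i}-\delta_{i,j}-y_j\partial_{y_i}$ if $i,j\in T$. $\mathcal B_{l_1,l_2}=\mathrm{Span}\{x^\alpha y^\beta\mid\sum_{i\in S}\alpha_i-\sum_{i\in T}\alpha_i=l_1,\ |\beta|=l_2\}$, which is $\{0\}$ for $l_2<0$. The operators $\Delta,\eta$ commute with $sl(n,\mathbb C)$. A highest weight module is one generated by a nonzero $v$ with $H.v\subset\mathbb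 Cv$ and $\mathcal G_+.v=0$ (a highest weight vector), whose weight is the highest weight. *)

(* Defs.v *)
From HB Require Import structures.
From mathcomp Require Import all_boot all_order all_algebra.
From mathcomp Require Import reals complex mpoly.

Set Implicit Arguments.
Unset Strict Implicit.
Unset Printing Implicit Defensive.

Import Order.TTheory GRing.Theory Num.Theory.
Local Open Scope ring_scope.

Definition lspan (K : fieldType) (V : lmodType K) (P : V -> Prop) (v : V)
    : Prop :=
  exists s : seq (K * V),
    (forall cu, cu \in s -> P cu.2) /\ v = \sum_(cu <- s) cu.1 *: cu.2.

(* The family [b], restricted to the indices in [D], is a basis of [M]. *)
Definition basis_of_family (K : fieldType) (V : lmodType K) (I : eqType)
    (D : I -> Prop) (b : I -> V) (M : V -> Prop) : Prop :=
  (forall (s : seq I) (c : I -> K), uniq s -> (forall i, i \in s -> D i) ->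
     \sum_(i <- s) c i *: b i = 0 -> forall i, i \in s -> c i = 0)
  /\ (forall v, M v <-> lspan (fun u => exists2 i, D i & u = b i) v).

Definition direct_sum (K : fieldType) (V : lmodType K) (M N P : V -> Prop)
    : Prop :=
  (forall v, M v <-> exists u w, [/\ N u, P w & v = u + w])
  /\ (forall v, N v -> P v -> v = 0).

(* The 2n variables of [{mpoly K[n + n]}] are x_1, ..., x_n, y_1, ..., y_n. *)
Definition xv (K : fieldType) (n : nat) (i : 'I_n) : {mpoly K[n + n]} :=
  'X_(lshift n i).
Definition yv (K : fieldType) (n : nat) (i : 'I_n) : {mpoly K[n + n]} :=
  'X_(rshift n i).
Definition dx (K : fieldType) (n : nat) (i : 'I_n) (f : {mpoly K[n + n]}) :
  {mpoly K[n + n]} := mderiv (lshift n i) f.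
Definition dy (K : fieldType) (n : nat) (i : 'I_n) (f : {mpoly K[n + n]}) :
  {mpoly K[n + n]} := mderiv (rshift n i) f.

Arguments xv K {n} i.
Arguments yv K {n} i.

Definition xymon (K : fieldType) (n : nat) (a b : 'X_{1..n}) :
    {mpoly K[n + n]} :=
  \prod_(i < n) xv K i ^+ a i * \prod_(i < n) yv K i ^+ b i.

(* Throughout, the partition (S, T) of the index set is given by [S], with
   T its complement. *)

Definition actE (K : fieldType) (n : nat) (S : {set 'I_n}) (i j : 'I_n)
    (f : {mpoly K[n + n]}) : {mpoly K[n + n]} :=
  match i \in S, j \in S with
  | true, true => xv K i * dx j f - yv K j * dy i f
  | true, false => - (xv K i * xv K j * f) - yv K j * dy i f
  | false, true => dx i (dx j f) - yv K j * dy i f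
  | false, false =>
      - (xv K j * dx i f) - (i == j)%:R *: f - yv K j * dy i f
  end.

Definition act (K : fieldType) (n : nat) (S : {set 'I_n}) (A : 'M[K]_n)
    (f : {mpoly K[n + n]}) : {mpoly K[n + n]} :=
  \sum_(i < n) \sum_(j < n) A i j *: actE S i j f.

(* sl(n, K) is the space of matrices of trace zero. *)
Definition submodule (K : fieldType) (n : nat) (S : {set 'I_n})
    (N : {mpoly K[n + n]} -> Prop) : Prop :=
  [/\ N 0,
      forall c u v, N u -> N v -> N (c *: u + v)
    & forall (A : 'M[K]_n) v, \tr A = 0 -> N v -> N (act S A v)].

Definition irreducible_module (K : fieldType) (n : nat) (S : {set 'I_n})
    (M : {mpoly K[n + n]} -> Prop) : Prop :=
  [/\ submodule S M,
      exists2 v, M v & v <> 0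
    & forall N, submodule S N -> (forall v, N v -> M v) ->
        (forall v, N v -> v = 0) \/ (forall v, M v -> N v)].

Definition cartan (K : fieldType) (n : nat) : 'M[K]_n -> Prop :=
  lspan (fun h => exists2 i : 'I_n * 'I_n, i.2 = i.1.+1 :> nat &
                  h = delta_mx i.1 i.1 - delta_mx i.2 i.2).

(* The linear form on diagonal matrices whose restriction to the Cartan
   subalgebra is lambda_i, see [fund_weightE]. *)
Definition fund_weight (K : fieldType) (n : nat) (i : nat) (A : 'M[K]_n) : K :=
  \sum_(k < n | (k < i)%N) A k k.

(* The ordinal j : 'I_n stands for the index j + 1 of the usual numbering. *)
Lemma fund_weightE (K : fieldType) (n i : nat) (j j' : 'I_n) :
  j' = j.+1 :> nat ->
  fund_weight i (delta_mx j j - delta_mx j' j' : 'M[K]_n) = (i == j.+1)%:R.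
Proof.
move=> jj'; rewrite /fund_weight.
have sE (k0 : 'I_n) :
    \sum_(k < n | (k < i)%N) (delta_mx k0 k0 : 'M[K]_n) k k = (k0 < i)%:R.
  case: ltnP => ki.
    rewrite (bigD1 k0) //= big1 ?addr0 ?mxE ?eqxx // => k /andP[_ /negbTE kk].
    by rewrite mxE kk.
  rewrite big1 // => k ki'; rewrite mxE; case: eqP => //= kk.
  by move: ki'; rewrite kk ltnNge ki.
under eq_bigr => k _ do rewrite mxE [X in _ + X]mxE.
rewrite sumrB !sE jj'.
by case: (ltngtP i j.+1) => [h|h|h];
   rewrite ?subrr // ?subr0 // ltnNge -ltnS h /= ?subr0 ?subrr.
Qed.

Lemma fund_weight0 (K : fieldType) (n : nat) (A : 'M[K]_n) :
  fund_weight 0 A = 0.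
Proof. by rewrite /fund_weight big_pred0. Qed.

Definition highest_weight_vector (K : fieldType) (n : nat) (S : {set 'I_n})
    (v : {mpoly K[n + n]}) : Prop :=
  [/\ v <> 0,
      forall A, cartan A -> exists c : K, act S A v = c *: v
    & forall i j : 'I_n, (i < j)%N -> act S (delta_mx i j) v = 0].

Definition has_weight (K : fieldType) (n : nat) (S : {set 'I_n})
    (v : {mpoly K[n + n]}) (mu : 'M[K]_n -> K) : Prop :=
  forall A, cartan A -> act S A v = mu A *: v.

Definition generated_by (K : fieldType) (n : nat) (S : {set 'I_n})
    (M : {mpoly K[n + n]} -> Prop) (v : {mpoly K[n + n]}) : Prop :=
  M v /\ forall N, submodule S N -> N v -> forall u, M u -> N u.

Definition highest_weight_module (K : fieldType) (n : nat) (S : {set 'I_n})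
    (M : {mpoly K[n + n]} -> Prop) : Prop :=
  submodule S M /\
  exists2 v, highest_weight_vector S v & generated_by S M v.

Definition highest_weight_module_of (K : fieldType) (n : nat) (S : {set 'I_n})
    (M : {mpoly K[n + n]} -> Prop) (mu : 'M[K]_n -> K)
    (v : {mpoly K[n + n]}) : Prop :=
  [/\ submodule S M, highest_weight_vector S v, generated_by S M v
    & has_weight S v mu].

Definition Bsp (K : fieldType) (n : nat) (S : {set 'I_n}) (l1 l2 : int) :
    {mpoly K[n + n]} -> Prop :=
  lspan (fun u => exists a b : 'X_{1..n},
    [/\ \sum_(i in S) (a i)%:Z - \sum_(i in ~: S) (a i)%:Z = l1,
        (mdeg b)%:Z = l2 & u = xymon K a b]).

(* From here on the rank n >= 2 is m.+2, S = {n} and T = {1, ..., n-1}; the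
   elements of T are the [idx_T i] with i : 'I_m.+1, and [idx_s] is the index
   s = n - 1. *)
Definition idx_n {m : nat} : 'I_m.+2 := ord_max.
Definition idx_T {m : nat} (i : 'I_m.+1) : 'I_m.+2 := widen_ord (leqnSn m.+1) i.
Definition idx_s {m : nat} : 'I_m.+2 := idx_T ord_max.
Definition Sn (m : nat) : {set 'I_m.+2} := [set idx_n].

Definition Delta (K : fieldType) (m : nat) (f : {mpoly K[m.+2 + m.+2]}) :
    {mpoly K[m.+2 + m.+2]} :=
  dx idx_n (dy idx_n f) - \sum_(i < m.+1) xv K (idx_T i) * dy (idx_T i) f.

Definition eta (K : fieldType) (m : nat) (f : {mpoly K[m.+2 + m.+2]}) :
    {mpoly K[m.+2 + m.+2]} :=
  xv K idx_n * yv K idx_n * f + \sum_(i < m.+1) yv K (idx_T i) * dx (idx_T i) f.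

Definition Hsp (K : fieldType) (m : nat) (l1 : int) (l2 : nat)
    (f : {mpoly K[m.+2 + m.+2]}) : Prop :=
  Bsp (Sn m) l1 l2%:Z f /\ Delta f = 0.

Definition etaB (K : fieldType) (m : nat) (l1 l2 : int)
    (f : {mpoly K[m.+2 + m.+2]}) : Prop :=
  exists2 g, Bsp (Sn m) l1 l2 g & f = eta g.

Definition hwv_pos (K : fieldType) (m l1 l2 : nat) : {mpoly K[m.+2 + m.+2]} :=
  \sum_(t < l2.+1)
    ((l1`! * l2`!)%:R / (t`! * (l1 + t)`! * (l2 - t)`!)%:R : K) *:
      (xv K idx_s ^+ t * xv K idx_n ^+ (l1 + t) *
       yv K idx_s ^+ (l2 - t) * yv K idx_n ^+ t).

(* The sum over all r_1, ..., r_{n-1} >= 0 has only zero terms outside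
   r_i <= b_i, because of the binomial coefficients; it is taken over the
   larger range r_i <= |b|. *)
Definition basis_poly (K : fieldType) (m : nat) (a b : 'X_{1..m.+2}) :
    {mpoly K[m.+2 + m.+2]} :=
  \sum_(r : {ffun 'I_m.+1 -> 'I_(mdeg b).+1})
    let rr := (\sum_(i < m.+1) r i)%N in
    (((a idx_n)`! * (b idx_n)`! * (\prod_(i < m.+1) 'C(b (idx_T i), r i)) * rr`!)%:R
       / ((a idx_n + rr)`! * (b idx_n + rr)`!)%:R : K) *:
      (xv K idx_n ^+ (a idx_n + rr) * yv K idx_n ^+ (b idx_n + rr) *
       \prod_(i < m.+1)
         (xv K (idx_T i) ^+ (a (idx_T i) + r i) * yv K (idx_T i) ^+ (b (idx_T i) - r i))).

Definition basis_index (m : nat) (l1 : int) (l2 : nat)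
    (ab : 'X_{1..m.+2} * 'X_{1..m.+2}) : Prop :=
  [/\ (ab.1 idx_n * ab.2 idx_n = 0)%N,
      (ab.1 idx_n)%:Z - \sum_(i < m.+1) (ab.1 (idx_T i))%:Z = l1
    & (\sum_(i < m.+2) ab.2 i = l2)%N].

(* Main.v *)
Require Import Defs.
From HB Require Import structures.
From mathcomp Require Import all_boot all_order all_algebra.
From mathcomp Require Import reals complex mpoly.
From mathcomp Require Import ring zify.
From mathcomp Require boolp.

Set Implicit Arguments.
Unset Strict Implicit.
Unset Printing Implicit Defensive.

Import Order.TTheory GRing.Theory Num.Theory.
Local Open Scope ring_scope.

(** Write u = x_n, w = y_n, D = sum_(i < n) x_i d_(y_i) and
    D' = sum_(i < n) y_i d_(x_i), so that Delta = d_u d_w - D and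
    eta = u w + D'. Both (Delta, eta) and (D, D') are sl_2-pairs: on each graded
    piece the commutator is a scalar, and going up the ladder of degrees one
    finds that Delta eta + c is bijective as soon as certain partial sums of
    these scalars do not vanish. For c = 0 this gives the decomposition.

    An element of ker Delta is determined by its monomials that are not
    divisible by u w, and every such boundary value u^a w^b p with a b = 0 is
    attained, by sum_k a! b! / ((a + k)! (b + k)!) u^(a + k) w^(b + k) D^k p;
    for a monomial p this is the basis element of the statement.

    A weight that drops under all positive root vectors shows that every nonzero
    submodule contains a singular vector, and comparing coefficients shows that
    the singular vectors of H are the multiples of the given one. Conversely
    this vector generates H: the E_(s,j) reach all boundary values of the same
    bidegree, the E_(n,j) lower the exponent of w, and they raise the exponent
    of u because a suitable D' D + c is surjective, by the ladder argument. *)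

(** The hypothesis on l_1 and l_2 is what the ladder for [Delta eta] asks for: its partial sums are
    (l_2 - j)(l_1 + j) for 0 <= j < l_2, and none of them vanishes exactly when l_1 > 0 or l_1 + l_2
    <= 0.

    As H is infinite-dimensional, complete reducibility is not at hand: a unique singular line does
    not give irreducibility until this line is shown to generate. The delicate point is raising the
    exponent of u. On a boundary value u^a p, the vector E_(n,j) gives - u^(a+1) (x_j p + y_j D p /
    (a + 1)), which mixes two terms. If all p of bidegree (d, e) are available, one may take p =
    d_(x_j) f with f of bidegree (d + 1, e) and sum over j; up to a nonzero factor the result is (D'
    D + (a + 1)(d + 1) - e) f. So the task is to solve this equation for f, and the hypothesis on
    l_1 and l_2 makes the partial sums of the corresponding ladder positive. *)

(** * Supports and weights of polynomials *)

Section Supports.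
Variables (K : numFieldType) (N : nat).
Implicit Types (f g : {mpoly K[N]}) (M : 'X_{1..N}) (P Q : 'X_{1..N} -> Prop).

Lemma mderiv_mulX i j f :
  mderiv i ('X_j * f) = (i == j)%:R * f + 'X_j * mderiv i f.
Proof.
rewrite mderivM mderivX mnm1E eq_sym; congr (_ * _ + _).
case: eqP => [->|_]; last by rewrite scale0r.
rewrite scale1r; suff -> : (U_(j) - U_(j))%MM = 0%MM by rewrite mpolyX0.
by apply/mnmP => k; rewrite mnmBE subnn mnm0E.
Qed.

Lemma mcoeff_mulX i f M : ('X_i * f)@_(U_(i) + M) = f@_M.
Proof. by rewrite -commr_mpolyX mcoeffMX. Qed.

Lemma mcoeff_mulX0 i f M : M i = 0%N -> ('X_i * f)@_M = 0.
Proof.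
move=> Mi; apply/eqP; rewrite mcoeff_eq0; apply/negP.
rewrite -commr_mpolyX (perm_mem (msuppMX _ _)) => /mapP[M' _ E].
by move: Mi; rewrite E mnmDE mnm1E eqxx.
Qed.

Lemma mcoeff_mulX_mderiv i f M : ('X_i * mderiv i f)@_M = (M i)%:R * f@_M.
Proof.
have [Mi|Mi] := posnP (M i); first by rewrite Mi mul0r mcoeff_mulX0.
have E : M = (U_(i) + (M - U_(i)))%MM.
  by rewrite addmC submK // lep1mP -lt0n.
rewrite {1}E mcoeff_mulX mcoeff_mderiv addmC -E mulr_natl; congr (_ *+ _).
by rewrite [in RHS]E mnmDE mnm1E eqxx.
Qed.

(** All graded pieces below are of this form, so closure under sums, products with variables and
    derivatives is proved once for all gradings. *)
Definition supp P f := forall M, f@_M != 0 -> P M.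

Lemma supp0 P : supp P 0.
Proof. by move=> M; rewrite mcoeff0 eqxx. Qed.

Lemma suppD P f g : supp P f -> supp P g -> supp P (f + g).
Proof.
move=> hf hg M; rewrite mcoeffD; have [->|/hf //] := eqVneq f@_M 0.
by rewrite add0r => /hg.
Qed.

Lemma suppZ P c f : supp P f -> supp P (c *: f).
Proof. by move=> hf M; rewrite mcoeffZ mulf_eq0 negb_or => /andP[_ /hf]. Qed.

Lemma suppN P f : supp P f -> supp P (- f).
Proof. by move=> hf M; rewrite mcoeffN oppr_eq0 => /hf. Qed.

Lemma suppB P f g : supp P f -> supp P g -> supp P (f - g).
Proof. by move=> hf hg; apply: suppD => //; apply: suppN. Qed.

Lemma supp_sum P (I : Type) (r : seq I) (p : pred I) (F : I -> {mpoly K[N]}) :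
  (forall i, p i -> supp P (F i)) -> supp P (\sum_(i <- r | p i) F i).
Proof.
by move=> h; elim/big_ind: _ => //; [exact: supp0 | exact: suppD].
Qed.

Lemma supp_impl P Q f : (forall M, P M -> Q M) -> supp P f -> supp Q f.
Proof. by move=> h hf M /hf /h. Qed.

Lemma supp_mulXm P Q m f :
  (forall M, P M -> Q (m + M)%MM) -> supp P f -> supp Q ('X_[m] * f).
Proof.
move=> h hf M; rewrite -mcoeff_msupp -commr_mpolyX (perm_mem (msuppMX _ _)).
by case/mapP => M' + ->; rewrite mcoeff_msupp => /hf /h.
Qed.

Lemma supp_mderiv P Q i f :
  (forall M, P (M + U_(i))%MM -> Q M) -> supp P f -> supp Q (mderiv i f).
Proof.
move=> h hf M; rewrite mcoeff_mderiv -mulr_natr mulf_eq0 negb_or.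
by case/andP=> /hf /h.
Qed.

Lemma suppX P m : P m -> supp P 'X_[m].
Proof.
move=> h M; rewrite mcoeffX; have [<- //|_] := eqVneq m M.
by rewrite eqxx.
Qed.

Definition wt (c : 'I_N -> int) M : int := \sum_i c i * (M i)%:Z.

Lemma wtD c M M' : wt c (M + M')%MM = wt c M + wt c M'.
Proof.
by rewrite -big_split; apply: eq_bigr => i _; rewrite mnmDE PoszD mulrDr.
Qed.

Lemma wtU c i : wt c U_(i)%MM = c i.
Proof.
rewrite /wt (bigD1 i) //= big1 ?mnm1E ?eqxx ?mulr1 ?addr0 //.
by move=> j ji; rewrite mnm1E eq_sym (negbTE ji) mulr0.
Qed.

Definition whomog c k f := supp (fun M => wt c M = k) f.

Lemma whomog_mulX c k l i f : whomog c k f -> l = k + c i -> whomog c l ('X_i * f).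
Proof. by move=> + ->; apply: supp_mulXm => M <-; rewrite wtD wtU addrC. Qed.

Lemma whomog_mderiv c k l i f :
  whomog c k f -> l = k - c i -> whomog c l (mderiv i f).
Proof. by move=> + ->; apply: supp_mderiv => M <-; rewrite wtD wtU addrK. Qed.

(** Each x_i d_i is diagonal on monomials. This weighted Euler identity is what turns the commutator
    of [Delta] and [eta] into a scalar. *)
Lemma whomog_euler c k f : whomog c k f ->
  \sum_i (c i)%:~R *: ('X_i * mderiv i f) = k%:~R *: f.
Proof.
move=> hf; apply/mpolyP => M; rewrite raddf_sum /= mcoeffZ.
under eq_bigr do rewrite mcoeffZ mcoeff_mulX_mderiv mulrA.
rewrite -mulr_suml; have [->|/hf <-] := eqVneq f@_M 0; first by rewrite !mulr0.
congr (_ * _); rewrite /wt rmorph_sum /=; apply: eq_bigr => i _.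
by rewrite rmorphM.
Qed.

End Supports.

(** * The ladder argument for sl_2-like pairs *)

Section Ladder.
Variables (K : fieldType) (V : lmodType K) (W : nat -> V -> Prop).
Variables (X Y : {linear V -> V}) (e : nat -> K).
Hypothesis Wlin : forall k a u v, W k u -> W k v -> W k (a *: u + v).
Hypothesis WX : forall k u, W k u -> W k.+1 (X u).
Hypothesis WY : forall k u, W k.+1 u -> W k (Y u).
Hypothesis WY0 : forall u, W 0 u -> Y u = 0.
Hypothesis XY : forall k u, W k u -> Y (X u) = X (Y u) + e k *: u.

(** On [W k.+1] the operator [Y X + c] equals [X Y + (c + e k.+1)], and [Y] intertwines the latter
    with [Y X + (c + e k.+1)] on [W k]. Each step down adds one more scalar to the constant; the
    sums in the hypothesis are the constants met on the way to degree 0. *)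
Lemma ladder_bijective k c :
  (forall j, (j <= k)%N -> c + \sum_(j <= i < k.+1) e i != 0) ->
  (forall u, W k u -> Y (X u) + c *: u = 0 -> u = 0) /\
  (forall g, W k g -> exists2 f, W k f & Y (X f) + c *: f = g).
Proof.
elim: k c => [|k IH] c hc.
  have c0 : e 0%N + c != 0 by have := hc 0%N isT; rewrite big_nat1 addrC.
  have E u : W 0 u -> Y (X u) + c *: u = (e 0%N + c) *: u.
    by move=> hu; rewrite (XY hu) (WY0 hu) linear0 add0r scalerDl.
  split=> [u hu|g hg].
    by rewrite E // => /eqP; rewrite scaler_eq0 (negbTE c0) => /eqP.
  have hg' : W 0 ((e 0%N + c)^-1 *: g).
    have W0 : W 0 0 by have := Wlin (-1) hg hg; rewrite scaleN1r addNr.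
    by have := Wlin (e 0%N + c)^-1 hg W0; rewrite addr0.
  by exists ((e 0%N + c)^-1 *: g) => //; rewrite E // scalerA mulfV // scale1r.
have hc' j : (j <= k)%N -> (c + e k.+1) + \sum_(j <= i < k.+1) e i != 0.
  move=> jk; have := hc j (leqW jk).
  by rewrite big_nat_recr ?leqW //= -addrA [e k.+1 + _]addrC.
have ck : c + e k.+1 != 0 by have := hc k.+1 (leqnn _); rewrite big_nat1.
have [inj surj] := IH _ hc'.
have E u : W k.+1 u -> Y (X u) + c *: u = X (Y u) + (c + e k.+1) *: u.
  by move=> hu; rewrite (XY hu) -addrA -scalerDl [e k.+1 + _]addrC.
split=> [u hu|g hg].
  rewrite E // => h.
  have Yu : Y u = 0.
    by apply: inj; [exact: WY | rewrite -linearZ -linearD h linear0].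
  by move: h; rewrite Yu linear0 add0r => /eqP;
     rewrite scaler_eq0 (negbTE ck) => /eqP.
(* Applying [Y] to [X (Y f) + (c + e k.+1) *: f = g] shows that [h = Y f] must solve the equation
   one level lower for [Y g]; the equation itself then determines [f] from [h]. *)
have [h hh Eh] := surj _ (WY hg).
have W0 : W k.+1 0 by have := Wlin (-1) hg hg; rewrite scaleN1r addNr.
have hf : W k.+1 ((c + e k.+1)^-1 *: (g - X h)).
  rewrite -[_ *: _]addr0; apply: Wlin => //.
  by rewrite -scaleN1r addrC; apply: Wlin => //; apply: WX.
exists ((c + e k.+1)^-1 *: (g - X h)) => //.
rewrite E // scalerA mulfV // scale1r linearZ /= linearB /=.
have -> : Y g - Y (X h) = (c + e k.+1) *: h by rewrite -Eh addrC addKr.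
by rewrite scalerA mulVf // scale1r addrC subrK.
Qed.

End Ladder.

(** * The four groups of variables *)

Section Coordinates.
Variable m : nat.

(* In the comments u and w stand for x_n and y_n, the variables [iu] and [iw]. *)
Definition ix (i : 'I_m.+1) : 'I_(m.+2 + m.+2) := lshift m.+2 (idx_T i).
Definition iu : 'I_(m.+2 + m.+2) := lshift m.+2 idx_n.
Definition iy (i : 'I_m.+1) : 'I_(m.+2 + m.+2) := rshift m.+2 (idx_T i).
Definition iw : 'I_(m.+2 + m.+2) := rshift m.+2 idx_n.

Lemma idx_T_lift (i : 'I_m.+1) : idx_T i = lift ord_max i.
Proof. by apply: val_inj; rewrite /= /bump leqNgt ltn_ord. Qed.

Lemma idx_T_eq (i j : 'I_m.+1) : (idx_T i == idx_T j) = (i == j).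
Proof. by []. Qed.

Lemma idx_T_neq (i : 'I_m.+1) : (idx_T i == idx_n) = false.
Proof. by rewrite -val_eqE /= ltn_eqF. Qed.

Lemma idx_n_neq (i : 'I_m.+1) : (idx_n == idx_T i) = false.
Proof. by rewrite eq_sym idx_T_neq. Qed.

Variant idx_spec : 'I_m.+2 -> Type :=
  | IdxT i : idx_spec (idx_T i)
  | IdxN : idx_spec idx_n.

Lemma idxP k : idx_spec k.
Proof.
case: (unliftP ord_max k) => [j ->|->]; last exact: IdxN.
by rewrite -idx_T_lift; exact: IdxT.
Qed.

Variant var_spec : 'I_(m.+2 + m.+2) -> Type :=
  | VarX i : var_spec (ix i)
  | VarU : var_spec iu
  | VarY i : var_spec (iy i)
  | VarW : var_spec iw.

Lemma varP k : var_spec k.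
Proof.
case: (split_ordP k) => j ->; case: (idxP j) => [i|].
- exact: VarX.
- exact: VarU.
- exact: VarY.
- exact: VarW.
Qed.

Lemma var_eqE :
  ((forall i j, (ix i == ix j) = (i == j)) *
   (forall i j, (iy i == iy j) = (i == j)) *
   (forall i, (ix i == iu) = false) * (forall i, (iu == ix i) = false) *
   (forall i, (iy i == iw) = false) * (forall i, (iw == iy i) = false) *
   (forall i, (ix i == iw) = false) * (forall i, (iw == ix i) = false) *
   (forall i, (iy i == iu) = false) * (forall i, (iu == iy i) = false) *
   (forall i j, (ix i == iy j) = false) * (forall i j, (iy i == ix j) = false) *
   ((iu == iw) = false) * ((iw == iu) = false))%type.
Proof.
by do 13?split; move=> *; rewrite ?eq_lshift ?eq_rshift ?eq_lrshift ?eq_rlshift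
   ?idx_T_eq ?idx_T_neq ?idx_n_neq ?eqxx.
Qed.

Lemma big_vars (V : nmodType) (F : 'I_(m.+2 + m.+2) -> V) :
  \sum_k F k = (\sum_i F (ix i) + F iu) + (\sum_i F (iy i) + F iw).
Proof. by rewrite big_split_ord /= !big_ord_recr. Qed.

(** The arguments are the weights of the x_i over T, of u, of the y_i over T and of w, in this
    order. *)
Definition var_wt (a : 'I_m.+1 -> int) (b : int) (c : 'I_m.+1 -> int) (d : int)
    (k : 'I_(m.+2 + m.+2)) : int :=
  match split k with
  | inl i => oapp a b (unlift ord_max i)
  | inr i => oapp c d (unlift ord_max i)
  end.

Lemma var_wtE a b c d :
  ((forall i, var_wt a b c d (ix i) = a i) * (var_wt a b c d iu = b) *
   (forall i, var_wt a b c d (iy i) = c i) * (var_wt a b c d iw = d))%type.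
Proof.
rewrite /var_wt; do 3?split; move=> *.
- by rewrite (unsplitK (inl _ : 'I_m.+2 + 'I_m.+2)) idx_T_lift liftK.
- by rewrite (unsplitK (inl _ : 'I_m.+2 + 'I_m.+2)) unlift_none.
- by rewrite (unsplitK (inr _ : 'I_m.+2 + 'I_m.+2)) idx_T_lift liftK.
- by rewrite (unsplitK (inr _ : 'I_m.+2 + 'I_m.+2)) unlift_none.
Qed.

Lemma wt_varE a b c d M :
  wt (var_wt a b c d) M =
    (\sum_i a i * (M (ix i))%:Z + b * (M iu)%:Z) +
    (\sum_i c i * (M (iy i))%:Z + d * (M iw)%:Z).
Proof.
rewrite /wt big_vars !var_wtE; congr (_ + _ + (_ + _));
by apply: eq_bigr => i _; rewrite var_wtE.
Qed.

Lemma mnm_varP (M M' : 'X_{1..m.+2 + m.+2}) :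
  (forall i, M (ix i) = M' (ix i)) -> M iu = M' iu ->
  (forall i, M (iy i) = M' (iy i)) -> M iw = M' iw -> M = M'.
Proof. by move=> hx hu hy hw; apply/mnmP => k; case: (varP k). Qed.

End Coordinates.
Arguments ix {m} i.
Arguments iu {m}.
Arguments iy {m} i.
Arguments iw {m}.

(** * The operators in coordinates *)

Section Operators.
Variables (K : numFieldType) (m : nat).
Local Notation V := {mpoly K[m.+2 + m.+2]}.
Implicit Types (f g : V) (i j : 'I_m.+1) (k : 'I_(m.+2 + m.+2)).

(** [Dxy] and [Dyx] are the D and D' of the overview. *)
Definition Dxy f : V := \sum_i 'X_(ix i) * mderiv (iy i) f.
Definition Dyx f : V := \sum_i 'X_(iy i) * mderiv (ix i) f.

Lemma Dxy_is_linear : linear Dxy.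
Proof.
move=> a f g; rewrite scaler_sumr -big_split; apply: eq_bigr => i _ /=.
by rewrite linearP mulrDr scalerAr.
Qed.
HB.instance Definition _ := GRing.isLinear.Build K V V _ Dxy Dxy_is_linear.

Lemma Dyx_is_linear : linear Dyx.
Proof.
move=> a f g; rewrite scaler_sumr -big_split; apply: eq_bigr => i _ /=.
by rewrite linearP mulrDr scalerAr.
Qed.
HB.instance Definition _ := GRing.isLinear.Build K V V _ Dyx Dyx_is_linear.

Lemma DeltaE f : Delta f = mderiv iu (mderiv iw f) - Dxy f.
Proof. by []. Qed.

Lemma etaE f : Defs.eta f = 'X_iu * 'X_iw * f + Dyx f.
Proof. by []. Qed.

Lemma Delta_is_linear : linear (@Delta K m).
Proof. by move=> a f g; rewrite !DeltaE !linearP /= scalerBr; ring. Qed.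
HB.instance Definition _ :=
  GRing.isLinear.Build K V V _ (@Delta K m) Delta_is_linear.

Lemma eta_is_linear : linear (@Defs.eta K m).
Proof.
by move=> a f g; rewrite !etaE linearP /= mulrDr scalerDr scalerAr addrACA.
Qed.
HB.instance Definition _ :=
  GRing.isLinear.Build K V V _ (@Defs.eta K m) eta_is_linear.

Lemma Dxy_M f g : Dxy (f * g) = Dxy f * g + f * Dxy g.
Proof.
rewrite mulr_suml mulr_sumr -big_split; apply: eq_bigr => i _ /=.
by rewrite mderivM; ring.
Qed.

Lemma mderivU k k' : mderiv k ('X_k' : V) = (k == k')%:R.
Proof. by rewrite -['X_k']mulr1 mderiv_mulX mderivC mulr0 addr0 mulr1. Qed.

Lemma sum_delta (F : 'I_m.+1 -> V) j : \sum_i F i * (i == j)%:R = F j.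
Proof.
rewrite (bigD1 j) //= eqxx mulr1 big1 ?addr0 // => i /negbTE ->.
by rewrite mulr0.
Qed.

Lemma DxyX :
  ((forall j, Dxy 'X_(ix j) = 0) * (Dxy 'X_iu = 0) *
   (forall j, Dxy 'X_(iy j) = 'X_(ix j)) * (Dxy 'X_iw = 0))%type.
Proof.
do 3?split; rewrite /Dxy => *; under eq_bigr do rewrite mderivU var_eqE;
  by rewrite ?sum_delta // big1 // => i _; rewrite mulr0.
Qed.

Lemma mderiv_Dxy k f :
  mderiv k (Dxy f) =
    Dxy (mderiv k f) + \sum_i (k == ix i)%:R * mderiv (iy i) f.
Proof.
rewrite /Dxy raddf_sum -big_split; apply: eq_bigr => i _ /=.
by rewrite mderiv_mulX [mderiv k (mderiv _ _)]mderiv_comm addrC.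
Qed.

Lemma mderiv_Dyx k f :
  mderiv k (Dyx f) =
    Dyx (mderiv k f) + \sum_i (k == iy i)%:R * mderiv (ix i) f.
Proof.
rewrite /Dyx raddf_sum -big_split; apply: eq_bigr => i _ /=.
by rewrite mderiv_mulX [mderiv k (mderiv _ _)]mderiv_comm addrC.
Qed.

Lemma mderiv_DxyE :
  ((forall j f, mderiv (ix j) (Dxy f) = (Dxy (mderiv (ix j) f) + mderiv (iy j) f)%R) *
   (forall f, mderiv iu (Dxy f) = Dxy (mderiv iu f)) *
   (forall j f, mderiv (iy j) (Dxy f) = Dxy (mderiv (iy j) f)) *
   (forall f, mderiv iw (Dxy f) = Dxy (mderiv iw f)))%type.
Proof.
do 3?split; move=> *; rewrite mderiv_Dxy;
  under eq_bigr do rewrite var_eqE 1?eq_sym mulrC;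
  by rewrite ?sum_delta // big1 ?addr0 // => i _; rewrite mulr0.
Qed.

Lemma mderiv_DyxE :
  ((forall j f, mderiv (ix j) (Dyx f) = Dyx (mderiv (ix j) f)) *
   (forall f, mderiv iu (Dyx f) = Dyx (mderiv iu f)) *
   (forall j f, mderiv (iy j) (Dyx f) = (Dyx (mderiv (iy j) f) + mderiv (ix j) f)%R) *
   (forall f, mderiv iw (Dyx f) = Dyx (mderiv iw f)))%type.
Proof.
do 3?split; move=> *; rewrite mderiv_Dyx;
  under eq_bigr do rewrite var_eqE 1?eq_sym mulrC;
  by rewrite ?sum_delta // big1 ?addr0 // => i _; rewrite mulr0.
Qed.

Lemma in_Sn_T i : (idx_T i \in Sn m) = false.
Proof. by rewrite inE idx_T_neq. Qed.

Lemma in_Sn_n : (idx_n \in Sn m) = true.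
Proof. by rewrite inE eqxx. Qed.

Lemma actETT i j f : actE (Sn m) (idx_T i) (idx_T j) f =
  - ('X_(ix j) * mderiv (ix i) f) - (i == j)%:R * f
  - 'X_(iy j) * mderiv (iy i) f.
Proof. by rewrite /actE !in_Sn_T idx_T_eq scaler_nat mulr_natl. Qed.

Lemma actETn i f : actE (Sn m) (idx_T i) idx_n f =
  mderiv (ix i) (mderiv iu f) - 'X_iw * mderiv (iy i) f.
Proof. by rewrite /actE in_Sn_T in_Sn_n. Qed.

Lemma actEnT j f : actE (Sn m) idx_n (idx_T j) f =
  - ('X_iu * 'X_(ix j) * f) - 'X_(iy j) * mderiv iw f.
Proof. by rewrite /actE in_Sn_T in_Sn_n. Qed.

Lemma actEnn f : actE (Sn m) idx_n idx_n f =
  'X_iu * mderiv iu f - 'X_iw * mderiv iw f.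
Proof. by rewrite /actE in_Sn_n. Qed.

Definition actEE := (actETT, actETn, actEnT, actEnn).

Lemma actE_is_linear (a b : 'I_m.+2) : linear (@actE K _ (Sn m) a b).
Proof.
move=> c f g; case: (idxP a) => [i|]; case: (idxP b) => [j|];
  rewrite !actEE !linearP /= -?mul_mpolyC; ring.
Qed.
HB.instance Definition _ (a b : 'I_m.+2) :=
  GRing.isLinear.Build K V V _ (@actE K _ (Sn m) a b) (actE_is_linear a b).

End Operators.

(* Over an abstract commutative ring, because rewriting and [ring] get lost
   unfolding the ring structure of [{mpoly K[n + n]}]. *)
Section AbstractCommutation.
Variables (V : comNzRingType) (I : Type) (D D' du dw : {additive V -> V}).
Variables (dx dy : I -> {additive V -> V}) (x y : I -> V) (u w : V).
Hypothesis D_x : forall j f, D (x j * f) = x j * D f.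
Hypothesis D_y : forall j f, D (y j * f) = y j * D f + x j * f.
Hypothesis D_u : forall f, D (u * f) = u * D f.
Hypothesis D_w : forall f, D (w * f) = w * D f.
Hypothesis dx_D : forall j f, dx j (D f) = D (dx j f) + dy j f.
Hypothesis dy_D : forall j f, dy j (D f) = D (dy j f).
Hypothesis du_D : forall f, du (D f) = D (du f).
Hypothesis dw_D : forall f, dw (D f) = D (dw f).
Hypothesis du_x : forall j f, du (x j * f) = x j * du f.
Hypothesis du_y : forall j f, du (y j * f) = y j * du f.
Hypothesis du_u : forall f, du (u * f) = u * du f + f.
Hypothesis du_w : forall f, du (w * f) = w * du f.
Hypothesis dw_x : forall j f, dw (x j * f) = x j * dw f.
Hypothesis dw_y : forall j f, dw (y j * f) = y j * dw f.
Hypothesis dw_u : forall f, dw (u * f) = u * dw f.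
Hypothesis dw_w : forall f, dw (w * f) = w * dw f + f.
Hypothesis du_dx : forall j f, du (dx j f) = dx j (du f).
Hypothesis du_dy : forall j f, du (dy j f) = dy j (du f).
Hypothesis dw_dx : forall j f, dw (dx j f) = dx j (dw f).
Hypothesis dw_dy : forall j f, dw (dy j f) = dy j (dw f).
Hypothesis dw_du : forall f, dw (du f) = du (dw f).
Hypothesis D'_u : forall f, D' (u * f) = u * D' f.
Hypothesis D'_w : forall f, D' (w * f) = w * D' f.
Hypothesis du_D' : forall f, du (D' f) = D' (du f).
Hypothesis dw_D' : forall f, dw (D' f) = D' (dw f).

Let addE := (raddfD D, raddfD D', raddfD du, raddfD dw,
  fun j => raddfD (dx j), fun j => raddfD (dy j)).
Let oppE := (raddfN D, raddfN D', raddfN du, raddfN dw,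
  fun j => raddfN (dx j), fun j => raddfN (dy j)).
Let simplE := (addE, oppE, D_x, D_y, D_u, D_w, dx_D, dy_D, du_D,
  dw_D, du_x, du_y, du_u, du_w, dw_x, dw_y, dw_u, dw_w, du_dx, du_dy, dw_dx,
  dw_dy, dw_du, D'_u, D'_w, du_D', dw_D').

Let L f := du (dw f) - D f.

(** This and the next three lemmas treat the four shapes of [actE], with [L] in the place of
    [Delta]; here [n] stands for the Kronecker symbol in E_(i,j). *)
Lemma abs_commTT i j (n : nat) f :
  let E f := - (x j * dx i f) - n%:R * f - y j * dy i f in
  L (E f) = E (L f).
Proof.
have natM (F : {additive V -> V}) g : F (n%:R * g) = n%:R * F g.
  by rewrite !mulr_natl raddfMn.
by rewrite /L /= !(simplE, natM D, natM du, natM dw, fun j => natM (dx j), fun j => natM (dy j)); ring.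
Qed.

Lemma abs_commTn i f :
  let E f := dx i (du f) - w * dy i f in L (E f) = E (L f).
Proof. by rewrite /L /= !simplE; ring. Qed.

Lemma abs_commnT j f :
  let E f := - (u * x j * f) - y j * dw f in L (E f) = E (L f).
Proof. by rewrite /L /= -!mulrA !simplE; ring. Qed.

Lemma abs_commnn f :
  let E f := u * du f - w * dw f in L (E f) = E (L f).
Proof. by rewrite /L /= !simplE; ring. Qed.

(** The commutator of [D] and [D'] enters as a parameter [h]: it is a sum over all of T, computed
    separately in [Dxy_Dyx]. *)
Lemma abs_comm_eta h f : D (D' f) = D' (D f) + h ->
  L (u * w * f + D' f) = u * w * L f + D' (L f) +
    (f + (u * du f + w * dw f) - h).
Proof. by move=> e; rewrite /L /= -!mulrA !simplE e; ring. Qed.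

End AbstractCommutation.

(** * Commutation of [Delta] with sl(n) and with [eta] *)

Section Commutation.
Variables (K : numFieldType) (m : nat).
Local Notation V := {mpoly K[m.+2 + m.+2]}.
Implicit Types (f g : V) (i j : 'I_m.+1).

Lemma Dxy_mulX f :
  ((forall i, Dxy ('X_(ix i) * f)%R = ('X_(ix i) * Dxy f)%R) *
   (Dxy ('X_iu * f)%R = ('X_iu * Dxy f)%R) *
   (forall i, Dxy ('X_(iy i) * f)%R = ('X_(iy i) * Dxy f + 'X_(ix i) * f)%R) *
   (Dxy ('X_iw * f)%R = ('X_iw * Dxy f)%R))%type.
Proof.
by do 3?split; move=> *; rewrite Dxy_M DxyX ?mul0r ?add0r // addrC.
Qed.

Lemma mderivu_mulX f :
  ((forall i, mderiv iu ('X_(ix i) * f)%R = ('X_(ix i) * mderiv iu f)%R) *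
   (mderiv iu ('X_iu * f)%R = ('X_iu * mderiv iu f + f)%R) *
   (forall i, mderiv iu ('X_(iy i) * f)%R = ('X_(iy i) * mderiv iu f)%R) *
   (mderiv iu ('X_iw * f)%R = ('X_iw * mderiv iu f)%R))%type.
Proof.
do 3?split; move=> *; rewrite mderiv_mulX ?var_eqE ?eqxx ?mul0r ?add0r //.
by rewrite mul1r addrC.
Qed.

Lemma mderivw_mulX f :
  ((forall i, mderiv iw ('X_(ix i) * f)%R = ('X_(ix i) * mderiv iw f)%R) *
   (mderiv iw ('X_iu * f)%R = ('X_iu * mderiv iw f)%R) *
   (forall i, mderiv iw ('X_(iy i) * f)%R = ('X_(iy i) * mderiv iw f)%R) *
   (mderiv iw ('X_iw * f)%R = ('X_iw * mderiv iw f + f)%R))%type.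
Proof.
do 3?split; move=> *; rewrite mderiv_mulX ?var_eqE ?eqxx ?mul0r ?add0r //.
by rewrite mul1r addrC.
Qed.

Lemma Delta_actE (a b : 'I_m.+2) f :
  Delta (actE (Sn m) a b f) = actE (Sn m) a b (Delta f).
Proof.
pose D : {additive V -> V} := @Dxy K m.
pose du : {additive V -> V} := @mderiv _ K iu.
pose dw : {additive V -> V} := @mderiv _ K iw.
pose dx j : {additive V -> V} := @mderiv _ K (ix j).
pose dy j : {additive V -> V} := @mderiv _ K (iy j).
pose x j : V := 'X_(ix j).
pose y j : V := 'X_(iy j).
have D_x j g : D (x j * g) = x j * D g := (Dxy_mulX g).1.1.1 j.
have D_u g : D ('X_iu * g) = 'X_iu * D g := (Dxy_mulX g).1.1.2.
have D_y j g : D (y j * g) = y j * D g + x j * g := (Dxy_mulX g).1.2 j.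
have D_w g : D ('X_iw * g) = 'X_iw * D g := (Dxy_mulX g).2.
have dx_D j g : dx j (D g) = D (dx j g) + dy j g := (mderiv_DxyE K m).1.1.1 j g.
have du_D g : du (D g) = D (du g) := (mderiv_DxyE K m).1.1.2 g.
have dy_D j g : dy j (D g) = D (dy j g) := (mderiv_DxyE K m).1.2 j g.
have dw_D g : dw (D g) = D (dw g) := (mderiv_DxyE K m).2 g.
have du_x j g : du (x j * g) = x j * du g := (mderivu_mulX g).1.1.1 j.
have du_u g : du ('X_iu * g) = 'X_iu * du g + g := (mderivu_mulX g).1.1.2.
have du_y j g : du (y j * g) = y j * du g := (mderivu_mulX g).1.2 j.
have du_w g : du ('X_iw * g) = 'X_iw * du g := (mderivu_mulX g).2.
have dw_x j g : dw (x j * g) = x j * dw g := (mderivw_mulX g).1.1.1 j.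
have dw_u g : dw ('X_iu * g) = 'X_iu * dw g := (mderivw_mulX g).1.1.2.
have dw_y j g : dw (y j * g) = y j * dw g := (mderivw_mulX g).1.2 j.
have dw_w g : dw ('X_iw * g) = 'X_iw * dw g + g := (mderivw_mulX g).2.
have du_dx j g : du (dx j g) = dx j (du g) := mderiv_comm _ _ g.
have du_dy j g : du (dy j g) = dy j (du g) := mderiv_comm _ _ g.
have dw_dx j g : dw (dx j g) = dx j (dw g) := mderiv_comm _ _ g.
have dw_dy j g : dw (dy j g) = dy j (dw g) := mderiv_comm _ _ g.
have dw_du g : dw (du g) = du (dw g) := mderiv_comm _ _ g.
case: (idxP a) => [i|]; case: (idxP b) => [j|]; rewrite !actEE !DeltaE.
- exact: (abs_commTT D_x D_y dx_D dy_D du_x du_y dw_x dw_y du_dx du_dy dw_dx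
    dw_dy).
- exact: (abs_commTn D_w dx_D dy_D du_D du_w dw_w du_dx du_dy dw_dx dw_dy
    dw_du).
- exact: (abs_commnT D_x D_y D_u dw_D du_x du_y du_u dw_x dw_y dw_u dw_du).
- exact: (abs_commnn D_u D_w du_D dw_D du_u du_w dw_u dw_w dw_du).
Qed.

Definition Eul_x f : V := \sum_i 'X_(ix i) * mderiv (ix i) f.
Definition Eul_y f : V := \sum_i 'X_(iy i) * mderiv (iy i) f.

(** The sl_2-relation: each pair x_i, y_i spans the two-dimensional module, and [Eul_x - Eul_y] is
    the Cartan element. *)
Lemma Dxy_Dyx f : Dxy (Dyx f) = Dyx (Dxy f) + (Eul_x f - Eul_y f).
Proof.
rewrite [Dyx f]/Dyx raddf_sum [in Dyx (Dxy f)]/Dyx -sumrB -big_split /=.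
apply: eq_bigr => i _; rewrite !Dxy_mulX !mderiv_DxyE mulrDr -!addrA.
by congr (_ + _); rewrite addrCA addrN addr0.
Qed.

Lemma Delta_eta f : Delta (Defs.eta f) = Defs.eta (Delta f) + (f
  + ('X_iu * mderiv iu f + 'X_iw * mderiv iw f) - (Eul_x f - Eul_y f)).
Proof.
pose D : {additive V -> V} := @Dxy K m.
pose D' : {additive V -> V} := @Dyx K m.
pose du : {additive V -> V} := @mderiv _ K iu.
pose dw : {additive V -> V} := @mderiv _ K iw.
have D_u g : D ('X_iu * g) = 'X_iu * D g := (Dxy_mulX g).1.1.2.
have D_w g : D ('X_iw * g) = 'X_iw * D g := (Dxy_mulX g).2.
have du_u g : du ('X_iu * g) = 'X_iu * du g + g := (mderivu_mulX g).1.1.2.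
have du_w g : du ('X_iw * g) = 'X_iw * du g := (mderivu_mulX g).2.
have dw_u g : dw ('X_iu * g) = 'X_iu * dw g := (mderivw_mulX g).1.1.2.
have dw_w g : dw ('X_iw * g) = 'X_iw * dw g + g := (mderivw_mulX g).2.
have du_D g : du (D' g) = D' (du g) := (mderiv_DyxE K m).1.1.2 g.
have dw_D g : dw (D' g) = D' (dw g) := (mderiv_DyxE K m).2 g.
rewrite !etaE !DeltaE.
exact: (abs_comm_eta D_u D_w du_u du_w dw_u dw_w du_D dw_D (Dxy_Dyx f)).
Qed.

End Commutation.

(** * The bigrading by l_1 and l_2 *)

Section Bigrading.
Variables (K : numFieldType) (m : nat).
Local Notation n := m.+2.
Local Notation V := {mpoly K[m.+2 + m.+2]}.
Implicit Types (f g : V) (i j : 'I_m.+1) (M : 'X_{1..n + n}).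

Definition mjoin (a b : 'X_{1..n}) : 'X_{1..n + n} :=
  [multinom match split k with inl i => a i | inr i => b i end | k < n + n].

Lemma mjoin_l a b k : mjoin a b (lshift n k) = a k.
Proof. by rewrite mnmE (unsplitK (inl k : 'I_n + 'I_n)). Qed.

Lemma mjoin_r a b k : mjoin a b (rshift n k) = b k.
Proof. by rewrite mnmE (unsplitK (inr k : 'I_n + 'I_n)). Qed.

Definition mjoinE := (mjoin_l, mjoin_r).

Lemma mjoin_split M :
  M = mjoin [multinom M (lshift n k) | k < n] [multinom M (rshift n k) | k < n].
Proof.
by apply/mnmP => k; case: (split_ordP k) => j ->; rewrite mjoinE mnmE.
Qed.

Lemma xymonE (a b : 'X_{1..n}) : xymon K a b = 'X_[mjoin a b].
Proof.
rewrite mpolyXE_id big_split_ord /=; congr (_ * _).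
  by apply: eq_bigr => k _; rewrite mjoin_l.
by apply: eq_bigr => k _; rewrite mjoin_r.
Qed.

Definition wt1 : 'I_(n + n) -> int := var_wt (fun=> -1) 1 (fun=> 0) 0.
Definition wt2 : 'I_(n + n) -> int := var_wt (fun=> 0) 0 (fun=> 1) 1.

Lemma wt1E M : wt wt1 M = (M iu)%:Z - \sum_i (M (ix i))%:Z.
Proof.
rewrite wt_varE mul1r mul0r addr0 [X in _ + X]big1 ?addr0; last first.
  by move=> i _; rewrite mul0r.
by rewrite addrC -sumrN; congr (_ + _); apply: eq_bigr => i _; rewrite mulN1r.
Qed.

Lemma wt2E M : wt wt2 M = \sum_i (M (iy i))%:Z + (M iw)%:Z.
Proof.
rewrite wt_varE mul1r mul0r addr0 [X in X + _]big1 ?add0r; last first.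
  by move=> i _; rewrite mul0r.
by congr (_ + _); apply: eq_bigr => i _; rewrite mul1r.
Qed.

Lemma sum_Sn (a : 'I_n -> int) :
  \sum_(k in Sn m) a k - \sum_(k in ~: Sn m) a k =
  a idx_n - \sum_i a (idx_T i).
Proof.
rewrite big_set1; congr (_ - _).
rewrite big_mkcond big_ord_recr /= !inE eqxx addr0.
by apply: eq_bigr => i _; rewrite !inE -/(idx_T i) idx_T_neq.
Qed.

Lemma sum_idx (V' : nmodType) (a : 'I_n -> V') :
  \sum_k a k = \sum_i a (idx_T i) + a idx_n.
Proof. exact: big_ord_recr. Qed.

Definition inB (l1 l2 : int) f := whomog wt1 l1 f /\ whomog wt2 l2 f.

Lemma inB0 l1 l2 : inB l1 l2 0. Proof. by split; apply: supp0. Qed.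

Lemma inBD l1 l2 f g : inB l1 l2 f -> inB l1 l2 g -> inB l1 l2 (f + g).
Proof. by move=> [? ?] [? ?]; split; apply: suppD. Qed.

Lemma inBN l1 l2 f : inB l1 l2 f -> inB l1 l2 (- f).
Proof. by move=> [? ?]; split; apply: suppN. Qed.

Lemma inBB l1 l2 f g : inB l1 l2 f -> inB l1 l2 g -> inB l1 l2 (f - g).
Proof. by move=> ? /inBN; exact: inBD. Qed.

Lemma inBZ l1 l2 c f : inB l1 l2 f -> inB l1 l2 (c *: f).
Proof. by move=> [? ?]; split; apply: suppZ. Qed.

Lemma inB_nat l1 l2 k f : inB l1 l2 f -> inB l1 l2 (k%:R * f).
Proof. by rewrite -scaler_nat -scalerAl mul1r; exact: inBZ. Qed.

Lemma inB_sum l1 l2 (I : Type) (r : seq I) (P : pred I) (F : I -> V) :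
  (forall t, P t -> inB l1 l2 (F t)) -> inB l1 l2 (\sum_(t <- r | P t) F t).
Proof. by move=> h; split; apply: supp_sum => t /h[]. Qed.

(** Replaces the span of monomials by a condition on the support, in which the degree shifts of
    operators can be read off. *)
Lemma BspP l1 l2 f : Bsp (Sn m) l1 l2 f <-> inB l1 l2 f.
Proof.
split=> [[s [hs ->]]|[h1 h2]].
  rewrite big_seq; apply: inB_sum => cu /hs[a [b [e1 e2 ->]]].
  apply: inBZ; rewrite xymonE; split; apply: suppX.
    by rewrite wt1E -e1 sum_Sn !mjoinE; congr (_ - _); apply: eq_bigr => i _;
      rewrite mjoinE.
  rewrite wt2E -e2 mdegE -(big_morph Posz PoszD (erefl _)) sum_idx !mjoinE.
  by congr (Posz (_ + _)); apply: eq_bigr => i _; rewrite mjoinE.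
exists [seq (f@_M, 'X_[M]) | M <- msupp f]; split; last first.
  by rewrite big_map; exact: mpolyE.
move=> cu /mapP[M]; rewrite mcoeff_msupp => hM -> /=.
exists [multinom M (lshift n k) | k < n], [multinom M (rshift n k) | k < n].
split.
- rewrite sum_Sn -(h1 _ hM) wt1E !mnmE; congr (_ - _).
  by apply: eq_bigr => i _; rewrite mnmE.
- rewrite -(h2 _ hM) wt2E mdegE -(big_morph Posz PoszD (erefl _)) sum_idx !mnmE.
  by congr (Posz (_ + _)); apply: eq_bigr => i _; rewrite mnmE.
by rewrite xymonE -mjoin_split.
Qed.

Lemma inB_mul l1 l2 l1' l2' k f : inB l1 l2 f ->
  l1' = l1 + wt1 k -> l2' = l2 + wt2 k -> inB l1' l2' ('X_k * f).
Proof.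
by move=> [h1 h2] e1 e2; split; [exact: whomog_mulX e1 | exact: whomog_mulX e2].
Qed.

Lemma inB_mderiv l1 l2 l1' l2' k f : inB l1 l2 f ->
  l1' = l1 - wt1 k -> l2' = l2 - wt2 k -> inB l1' l2' (mderiv k f).
Proof.
by move=> [h1 h2] e1 e2; split;
   [exact: whomog_mderiv e1 | exact: whomog_mderiv e2].
Qed.


Lemma inB_mulu l1 l2 f : inB l1 l2 f -> inB (l1 + 1) l2 ('X_iu * f).
Proof. by move=> h; apply: (inB_mul h); rewrite /wt1 /wt2 !var_wtE ?addr0. Qed.
Lemma inB_mulw l1 l2 f : inB l1 l2 f -> inB l1 (l2 + 1) ('X_iw * f).
Proof. by move=> h; apply: (inB_mul h); rewrite /wt1 /wt2 !var_wtE ?addr0. Qed.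
Lemma inB_mulx i l1 l2 f : inB l1 l2 f -> inB (l1 - 1) l2 ('X_(ix i) * f).
Proof. by move=> h; apply: (inB_mul h); rewrite /wt1 /wt2 !var_wtE ?addr0. Qed.
Lemma inB_muly i l1 l2 f : inB l1 l2 f -> inB l1 (l2 + 1) ('X_(iy i) * f).
Proof. by move=> h; apply: (inB_mul h); rewrite /wt1 /wt2 !var_wtE ?addr0. Qed.
Lemma inB_du l1 l2 f : inB (l1 + 1) l2 f -> inB l1 l2 (mderiv iu f).
Proof.
by move=> h; apply: (inB_mderiv h); rewrite /wt1 /wt2 !var_wtE ?subr0 ?addrK.
Qed.
Lemma inB_dw l1 l2 f : inB l1 (l2 + 1) f -> inB l1 l2 (mderiv iw f).
Proof.
by move=> h; apply: (inB_mderiv h); rewrite /wt1 /wt2 !var_wtE ?subr0 ?addrK.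
Qed.
Lemma inB_dx i l1 l2 f : inB (l1 - 1) l2 f -> inB l1 l2 (mderiv (ix i) f).
Proof.
move=> h; apply: (inB_mderiv h); rewrite /wt1 /wt2 !var_wtE ?subr0 //.
by rewrite opprK subrK.
Qed.
Lemma inB_dy i l1 l2 f : inB l1 (l2 + 1) f -> inB l1 l2 (mderiv (iy i) f).
Proof.
by move=> h; apply: (inB_mderiv h); rewrite /wt1 /wt2 !var_wtE ?subr0 ?addrK.
Qed.

Lemma inB_Dxy l1 l2 f : inB (l1 + 1) (l2 + 1) f -> inB l1 l2 (Dxy f).
Proof.
move=> h; apply: inB_sum => i _; rewrite -[l1](addrK 1).
by apply: inB_mulx; apply: inB_dy.
Qed.

Lemma inB_Delta l1 l2 f : inB (l1 + 1) (l2 + 1) f -> inB l1 l2 (Delta f).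
Proof.
move=> h; rewrite DeltaE; apply: inBB; last exact: inB_Dxy.
by apply: inB_du; apply: inB_dw.
Qed.

Lemma inB_eta l1 l2 f : inB l1 l2 f -> inB (l1 + 1) (l2 + 1) (Defs.eta f).
Proof.
move=> h; rewrite etaE; apply: inBD.
  by rewrite -mulrA; apply: inB_mulu; apply: inB_mulw.
apply: inB_sum => i _; apply: inB_muly; apply: inB_dx.
by rewrite addrK.
Qed.

Lemma inB_actE (a b : 'I_n) l1 l2 f :
  inB l1 l2 f -> inB l1 l2 (actE (Sn m) a b f).
Proof.
move=> h; case: (idxP a) => [i|]; case: (idxP b) => [j|]; rewrite actEE.
- apply: inBB; [apply: inBB|].
  + by apply: inBN; rewrite -[l1](addrK 1); apply: inB_mulx; apply: inB_dx;
      rewrite addrK.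
  + exact: inB_nat.
  + by rewrite -[l2](subrK 1); apply: inB_muly; apply: inB_dy; rewrite subrK.
- apply: inBB.
  + by apply: inB_dx; apply: inB_du; rewrite subrK.
  + by rewrite -[l2](subrK 1); apply: inB_mulw; apply: inB_dy; rewrite subrK.
- apply: inBB.
  + apply: inBN; rewrite -mulrA -[l1](subrK 1).
    by apply: inB_mulu; apply: inB_mulx.
  + by rewrite -[l2](subrK 1); apply: inB_muly; apply: inB_dw; rewrite subrK.
- apply: inBB.
  + by rewrite -[l1](subrK 1); apply: inB_mulu; apply: inB_du; rewrite subrK.
  + by rewrite -[l2](subrK 1); apply: inB_mulw; apply: inB_dw; rewrite subrK.
Qed.

Lemma HspP l1 (l2 : nat) f : Hsp l1 l2 f <-> inB l1 l2 f /\ Delta f = 0.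
Proof. by split=> -[/BspP]. Qed.

Lemma Hsp_submodule l1 l2 : submodule (Sn m) (@Hsp K m l1 l2).
Proof.
split; first by apply/HspP; rewrite linear0; split => //; exact: inB0.
  move=> c u v /HspP[hu eu] /HspP[hv ev]; apply/HspP.
  by rewrite linearP /= eu ev scaler0 addr0; split=> //; apply/inBD/hv/inBZ.
move=> A v _ /HspP[hv ev]; apply/HspP; split.
  by apply: inB_sum => i _; apply: inB_sum => j _; apply/inBZ/inB_actE.
rewrite /act linear_sum big1 // => i _; rewrite linear_sum big1 // => j _.
by rewrite linearZ /= Delta_actE ev linear0 scaler0.
Qed.

(* On the span of degree (l1, l2) the operators x_T d_(x_T) - u d_u and
   y_T d_(y_T) + w d_w act as the scalars - l1 and l2. *)
Lemma Delta_eta_comm l1 l2 f : inB l1 l2 f ->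
  Delta (Defs.eta f) = Defs.eta (Delta f) + (l1 + l2 + 1)%:~R *: f.
Proof.
move=> [h1 h2]; rewrite Delta_eta; congr (_ + _).
have:= whomog_euler h1; have := whomog_euler h2; rewrite !big_vars.
rewrite /wt1 /wt2 !var_wtE !scale0r !scale1r !addr0.
under eq_bigr do rewrite var_wtE scale0r.
under [X in _ + (X + _)]eq_bigr do rewrite var_wtE scale1r.
rewrite big1 // add0r -/(Eul_y f) => e2.
under eq_bigr do rewrite var_wtE scaleN1r.
under [X in _ + X]eq_bigr do rewrite var_wtE scale0r.
rewrite [X in _ + X]big1 // addr0 sumrN -/(Eul_x f) => e1.
rewrite !rmorphD !scalerDl /= -e1 -e2 scale1r.
by set a := 'X_iu * _; set b := 'X_iw * _; rewrite opprD opprK; ring.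
Qed.

End Bigrading.

(** The scalars along every ladder used below form an arithmetic progression; the factored sum shows
    when it vanishes. *)
Lemma sum_arith (a s : int) (j k : nat) : (j <= k)%N ->
  \sum_(j <= i < k) (a + s * (2 * i%:Z + 1)) =
    (k%:Z - j%:Z) * (a + s * (k%:Z + j%:Z)).
Proof.
move=> /subnKC <-; elim: (k - j)%N => [|d IH].
  by rewrite big_geq ?addn0 // subrr mul0r.
by rewrite addnS big_nat_recr ?leq_addr //= IH -addn1 !PoszD; ring.
Qed.

(** * The decomposition, and harmonic polynomials modulo u w *)

Section Decomposition.
Variables (K : numFieldType) (m : nat).
Local Notation V := {mpoly K[m.+2 + m.+2]}.
Implicit Types (f g : V) (i j : 'I_m.+1) (M : 'X_{1..m.+2 + m.+2}).

Lemma inB_neg l1 l2 f : l2 < 0 -> inB l1 l2 f -> f = 0.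
Proof.
move=> l20 [_ h]; apply/mpolyP => M; rewrite mcoeff0; apply/eqP.
apply: contraTT l20 => /h <-; rewrite wt2E -leNgt addr_ge0 //.
by apply: sumr_ge0.
Qed.

(** Here [l2] is one less than in the decomposition. The ladder runs through the pieces of bidegree
    (l1 - l2 - 1 + k, k), where the commutator is l1 - l2 + 2k; its sum from j to l2 is (l2 + 1 -
    j)(l1 + j). *)
Lemma Delta_eta_bijective (l1 : int) (l2 : nat) : l1 + l2.+1%:Z <= 0 \/ 0 < l1 ->
  (forall f, inB (l1 - 1) l2 f -> Delta (Defs.eta f) = 0 -> f = 0) /\
  (forall g, inB (l1 - 1) l2 g ->
     exists2 f, inB (l1 - 1) l2 f & Delta (Defs.eta f) = g).
Proof.
move=> hl; pose W (k : nat) f := inB (l1 - l2.+1%:Z + k%:Z) k f.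
pose e (k : nat) : K := (l1 - l2.+1%:Z + k%:Z + k%:Z + 1)%:~R.
have We : W l2 = inB (l1 - 1) l2.
  by rewrite /W; congr inB; rewrite -addn1 PoszD; ring.
rewrite -We.
have [] := @ladder_bijective K V W (@Defs.eta K m) (@Delta K m) e
    _ _ _ _ _ l2 0.
- by move=> k a u v hu hv; apply/inBD/hv/inBZ.
- move=> k u hu; rewrite /W -[k.+1]addn1 PoszD addrA; exact: inB_eta.
- move=> k u hu; apply: inB_Delta; rewrite -addrA.
  by by rewrite -PoszD addn1.
- move=> u hu; apply: (@inB_neg (l1 - l2.+1%:Z + 0%:Z - 1) (-1)) => //.
  by apply: inB_Delta; rewrite subrK addNr.
- by move=> k u hu; apply: Delta_eta_comm.
- move=> j jl; rewrite add0r /e -rmorph_sum intr_eq0.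
  under eq_bigr do rewrite -addrA -addrA.
  rewrite (eq_bigr (fun i : nat => (l1 - l2.+1%:Z) + 1 * (2 * i%:Z + 1))).
    rewrite sum_arith ?leqW // mulf_neq0 //; first by lia.
    by case: hl => hl; lia.
  by move=> i _; ring.
move=> inj surj; split.
  by move=> f hf h; apply: inj => //; rewrite scale0r addr0.
move=> g /surj[f hf]; rewrite scale0r addr0 => <-; by exists f.
Qed.

Lemma Hsp_decomposition (l1 : int) (l2 : nat) : l1 + l2%:Z <= 0 \/ 0 < l1 ->
  direct_sum (@Bsp K m.+2 (Sn m) l1 l2%:Z) (@Hsp K m l1 l2)
    (@etaB K m (l1 - 1) (l2%:Z - 1)).
Proof.
(* For [l2 = 0] the second summand comes from second degree -1 and is zero, and [Delta] kills the
   whole piece. *)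
case: l2 => [|l2] hl.
  have D0 f : inB l1 0 f -> Delta f = 0.
    move=> hf; apply: (@inB_neg (l1 - 1) (-1)) => //.
    by apply: inB_Delta; rewrite subrK addNr.
  have eta0 f : etaB (l1 - 1) (0 - 1) f -> f = 0.
    case=> g /BspP hg ->; suff -> : g = 0 by rewrite linear0.
    by apply: inB_neg hg.
  split=> [f|f _ /eta0 //]; split.
    move=> hf; exists f, 0; rewrite addr0; split=> //.
      by split=> //; apply/D0/BspP.
    by exists 0; rewrite ?linear0 //; apply/BspP; exact: inB0.
  by case=> u [w [[hu _] /eta0 -> ->]]; rewrite addr0.
have -> : l2.+1%:Z - 1 = l2 by rewrite -addn1 PoszD addrK.
have [inj surj] := Delta_eta_bijective hl.
have S1 : l2%:Z + 1 = l2.+1 by rewrite -addn1.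
split=> [f|f [hf Df] [g /BspP hg ef]]; last first.
  by rewrite ef (inj g) ?linear0 // -ef.
split=> [/BspP hf|[u [w [[/BspP hu _] [g /BspP hg ->] ->]]]]; last first.
  by apply/BspP/inBD => //; rewrite -[l1](subrK 1) -S1; exact: inB_eta.
(* The component of [f] in the image of [eta] must have the same image under [Delta] as [f]. *)
have [|g hg eg] := surj (Delta f); first by apply: inB_Delta; rewrite subrK S1.
have he : inB l1 l2.+1 (Defs.eta g).
  by rewrite -[l1](subrK 1) -S1; exact: inB_eta.
exists (f - Defs.eta g), (Defs.eta g); split; last by rewrite subrK.
  by split; [apply/BspP/inBB | rewrite linearB /= eg subrr].
by exists g => //; apply/BspP.
Qed.

(* Comparing coefficients of u^a w^b in [Delta f = 0] determines the
   coefficient of u^(a+1) w^(b+1) from those with smaller exponent of u. *)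
Lemma ker_Delta_determined f : Delta f = 0 ->
  (forall M, (M iu * M iw = 0)%N -> f@_M = 0) -> f = 0.
Proof.
move=> Df h0; suff hk k M : M iu = k -> f@_M = 0.
  by apply/mpolyP => M; rewrite mcoeff0 (hk _ _ (erefl _)).
elim: k M => [|k IH] M Mu; first by apply: h0; rewrite Mu.
have [Mw|Mw] := eqVneq (M iw) 0%N; first by apply: h0; rewrite Mw muln0.
pose M' := (M - U_(iu) - U_(iw))%MM.
have EM : (M' + U_(iu) + U_(iw))%MM = M.
  apply/mnmP => t; rewrite !mnmDE !mnmBE !mnm1E.
  case: (varP t) => [?||?|]; rewrite ?var_eqE ?eqxx /= ?subn0 ?addn0 //.
    by rewrite subn1 addn1 Mu.
  by rewrite subn1 addn1 prednK // lt0n.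
have M'u : M' iu = k by rewrite !mnmBE !mnm1E eqxx var_eqE Mu subn1 subn0.
have : (Delta f)@_M' = 0 by rewrite Df mcoeff0.
rewrite DeltaE mcoeffB !mcoeff_mderiv EM [(Dxy f)@__]raddf_sum /= big1 => [|i _].
  by rewrite subr0 => /eqP; rewrite !mulrn_eq0 => /eqP.
have [Mi|Mi] := eqVneq (M' (ix i)) 0%N; first by rewrite mcoeff_mulX0.
have -> : M' = (U_(ix i) + (M' - U_(ix i)))%MM by rewrite addmC submK // lep1mP.
rewrite mcoeff_mulX mcoeff_mderiv IH ?mul0rn //.
by rewrite mnmDE mnmBE !mnm1E !var_eqE subn0 addn0.
Qed.

End Decomposition.

(** * Harmonic lifts of boundary values *)

Section Lift.
Variables (K : numFieldType) (m : nat).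
Local Notation n := m.+2.
Local Notation V := {mpoly K[m.+2 + m.+2]}.
Implicit Types (f g p : V) (i j : 'I_m.+1) (M : 'X_{1..m.+2 + m.+2}).

Definition bideg (d e : nat) (M : 'X_{1..n + n}) : Prop :=
  [/\ M iu = 0, M iw = 0, \sum_i M (ix i) = d & \sum_i M (iy i) = e]%N.

Local Notation inXY d e := (supp (bideg d e)).

Lemma sum_mnmD (F : 'I_m.+1 -> 'I_(n + n)) M M' :
  (\sum_i (M + M')%MM (F i) = \sum_i M (F i) + \sum_i M' (F i))%N.
Proof. by rewrite -big_split; apply: eq_bigr => i _; rewrite mnmDE. Qed.

Lemma sum_mnm1 (F : 'I_m.+1 -> 'I_(n + n)) j : injective F ->
  (\sum_i U_(F j)%MM (F i) = 1)%N.
Proof.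
move=> injF; rewrite (bigD1 j) //= mnm1E eqxx big1 // => i ij.
by rewrite mnm1E (inj_eq injF) eq_sym (negbTE ij).
Qed.

Lemma sum_mnm0 (F : 'I_m.+1 -> 'I_(n + n)) k : (forall i, k != F i) ->
  (\sum_i U_(k)%MM (F i) = 0)%N.
Proof. by move=> h; rewrite big1 // => i _; rewrite mnm1E (negbTE (h i)). Qed.

Lemma ix_inj : injective (@ix m).
Proof. by move=> i j /eqP; rewrite var_eqE => /eqP. Qed.
Lemma iy_inj : injective (@iy m).
Proof. by move=> i j /eqP; rewrite var_eqE => /eqP. Qed.

Lemma bideg_Ux j d e M : bideg d.+1 e (U_(ix j) + M)%MM <-> bideg d e M.
Proof.
rewrite /bideg !mnmDE !mnm1E !var_eqE !sum_mnmD sum_mnm1 ?sum_mnm0 //.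
- by split=> -[? ? ? ?]; split; lia.
- by move=> i; rewrite var_eqE.
- exact: ix_inj.
Qed.

Lemma bideg_Uy j d e M : bideg d e.+1 (U_(iy j) + M)%MM <-> bideg d e M.
Proof.
rewrite /bideg !mnmDE !mnm1E !var_eqE !sum_mnmD sum_mnm0 ?sum_mnm1 //.
- by split=> -[? ? ? ?]; split; lia.
- exact: iy_inj.
- by move=> i; rewrite var_eqE.
Qed.

Lemma inXY_mulx j d e f : inXY d e f -> inXY d.+1 e ('X_(ix j) * f).
Proof. by apply: supp_mulXm => M hM; apply/bideg_Ux. Qed.

Lemma inXY_muly j d e f : inXY d e f -> inXY d e.+1 ('X_(iy j) * f).
Proof. by apply: supp_mulXm => M hM; apply/bideg_Uy. Qed.

Lemma inXY_dx j d e f : inXY d.+1 e f -> inXY d e (mderiv (ix j) f).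
Proof. by apply: supp_mderiv => M; rewrite addmC => /bideg_Ux. Qed.

Lemma inXY_dy j d e f : inXY d e.+1 f -> inXY d e (mderiv (iy j) f).
Proof. by apply: supp_mderiv => M; rewrite addmC => /bideg_Uy. Qed.

Lemma inXY_Dxy d e f : inXY d e.+1 f -> inXY d.+1 e (Dxy f).
Proof. by move=> h; apply: supp_sum => i _; apply/inXY_mulx/inXY_dy. Qed.

Lemma inXY_Dyx d e f : inXY d.+1 e f -> inXY d e.+1 (Dyx f).
Proof. by move=> h; apply: supp_sum => i _; apply/inXY_muly/inXY_dx. Qed.

Lemma mderiv_eq0 k f : supp (fun M => M k = 0%N) f -> mderiv k f = 0.
Proof.
move=> h; apply/mpolyP => M; rewrite mcoeff_mderiv mcoeff0.
suff -> : f@_(M + U_(k)) = 0 by rewrite mul0rn.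
apply/eqP; apply/negP => /negP /h; rewrite mnmDE mnm1E eqxx addn1; discriminate.
Qed.

Lemma inXY_du d e f : inXY d e f -> mderiv iu f = 0.
Proof. by move=> h; apply: mderiv_eq0; apply: supp_impl h => M []. Qed.

Lemma inXY_dw d e f : inXY d e f -> mderiv iw f = 0.
Proof. by move=> h; apply: mderiv_eq0; apply: supp_impl h => M []. Qed.

Lemma sum_nat0 (F : 'I_m.+1 -> nat) i : (\sum_i F i = 0)%N -> F i = 0%N.
Proof. by move/eqP; rewrite sum_nat_eq0 => /forallP/(_ i)/eqP. Qed.

Lemma inXY_Dxy0 d f : inXY d 0 f -> Dxy f = 0.
Proof.
move=> h; rewrite /Dxy big1 // => i _; rewrite mderiv_eq0 ?mulr0 //.
by apply: supp_impl h => M [_ _ _ h]; apply: (sum_nat0 _ h).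
Qed.

Lemma inXY_Dyx0 e f : inXY 0 e f -> Dyx f = 0.
Proof.
move=> h; rewrite /Dyx big1 // => i _; rewrite mderiv_eq0 ?mulr0 //.
by apply: supp_impl h => M [_ _ h _]; apply: (sum_nat0 _ h).
Qed.

Lemma inXY_Eul_x d e f : inXY d e f -> Eul_x f = d%:R *: f.
Proof.
move=> h; apply/mpolyP => M; rewrite raddf_sum /= mcoeffZ.
under eq_bigr do rewrite mcoeff_mulX_mderiv.
rewrite -mulr_suml -natr_sum; have [->|/h] := eqVneq f@_M 0; first by rewrite !mulr0.
by case=> _ _ ->.
Qed.

Lemma inXY_Eul_y d e f : inXY d e f -> Eul_y f = e%:R *: f.
Proof.
move=> h; apply/mpolyP => M; rewrite raddf_sum /= mcoeffZ.
under eq_bigr do rewrite mcoeff_mulX_mderiv.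
rewrite -mulr_suml -natr_sum; have [->|/h] := eqVneq f@_M 0; first by rewrite !mulr0.
by case=> _ _ _ ->.
Qed.

Lemma inXY_iter_Dxy k d e f : inXY d e f -> (k <= e)%N ->
  inXY (d + k) (e - k) (iter k (@Dxy K m) f).
Proof.
move=> h; elim: k => [|k IH] ke; first by rewrite addn0 subn0.
rewrite iterS [(d + _)%N]addnS; apply: inXY_Dxy; rewrite -subSn // subSS.
exact/IH/ltnW.
Qed.

(** [Dxy] trades a y for an x, so its powers stop after [e] steps; any truncation of the lift beyond
    [e] is therefore the full series. *)
Lemma iter_Dxy0 k d e f : inXY d e f -> (e < k)%N ->
  iter k (@Dxy K m) f = 0.
Proof.
move=> h ek; rewrite -(subnK ek) iterD iterS.
have := inXY_iter_Dxy h (leqnn e); rewrite subnn => /inXY_Dxy0 ->.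
by elim: (k - _)%N => //= l ->; rewrite linear0.
Qed.

Lemma inB_mulXn (k : 'I_(n + n)) (N : nat) l1 l2 f : inB l1 l2 f ->
  inB (l1 + N%:Z * wt1 k) (l2 + N%:Z * wt2 k) ('X_k ^+ N * f).
Proof.
move=> h; elim: N => [|N IH]; first by rewrite !mul0r !addr0 expr0 mul1r.
by rewrite exprS -mulrA; apply: (inB_mul IH); rewrite -addn1 PoszD; ring.
Qed.

(* [hlift N a b p] is the harmonic polynomial whose part not divisible by u w is
   u^a w^b p, provided that a b = 0 and that [Dxy ^ N] kills [p]. *)
Definition hlift_coef (a b k : nat) : K :=
  (a`! * b`!)%:R / ((a + k)`! * (b + k)`!)%:R.

Definition hlift (N a b : nat) (p : V) : V :=
  \sum_(k < N) hlift_coef a b k *: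
    ('X_iu ^+ (a + k) * 'X_iw ^+ (b + k) * iter k (@Dxy K m) p).

Lemma iter_Dxy_linear k : linear (iter k (@Dxy K m)).
Proof. by move=> c f g; elim: k => //= k ->; rewrite linearP. Qed.

Lemma hlift_is_linear N a b : linear (hlift N a b).
Proof.
move=> c f g; rewrite scaler_sumr -big_split; apply: eq_bigr => k _ /=.
by rewrite iter_Dxy_linear mulrDr scalerDr -scalerAr !scalerA mulrC.
Qed.
HB.instance Definition _ N a b :=
  GRing.isLinear.Build K V V _ (hlift N a b) (hlift_is_linear N a b).

(** The recursion by which d_u d_w of the term [k + 1] cancels D of the term [k]. *)
Lemma hlift_coefS a b k :
  hlift_coef a b k.+1 * ((a + k.+1)%:R * (b + k.+1)%:R) = hlift_coef a b k.
Proof.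
rewrite /hlift_coef !addnS !factS !natrM.
have fn0 (t : nat) : (t`!%:R : K) != 0 by rewrite pnatr_eq0 -lt0n fact_gt0.
have sn0 (t : nat) : (t.+1%:R : K) != 0 by rewrite pnatr_eq0.
have := sn0 (a + k)%N; have := sn0 (b + k)%N.
by move: (a + k)%N (b + k)%N => A B hB hA; field; rewrite !fn0 ![1 + _]addrC !natr1 hA hB.
Qed.

Lemma mderivXn_u N f : mderiv iu f = 0 ->
  mderiv iu ('X_iu ^+ N * f) = N%:R *: ('X_iu ^+ N.-1 * f).
Proof.
move=> f0; elim: N => [|N IH]; first by rewrite scale0r expr0 mul1r.
rewrite exprS -mulrA mderivu_mulX IH -[N.+1%:R]natr1 scalerDl scale1r.
congr (_ + _); rewrite -scalerAr; case: N {IH} => [|N]; first by rewrite !scale0r.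
by rewrite mulrA -exprS.
Qed.

Lemma mderivXn_w N f : mderiv iw f = 0 ->
  mderiv iw ('X_iw ^+ N * f) = N%:R *: ('X_iw ^+ N.-1 * f).
Proof.
move=> f0; elim: N => [|N IH]; first by rewrite scale0r expr0 mul1r.
rewrite exprS -mulrA mderivw_mulX IH -[N.+1%:R]natr1 scalerDl scale1r.
congr (_ + _); rewrite -scalerAr; case: N {IH} => [|N]; first by rewrite !scale0r.
by rewrite mulrA -exprS.
Qed.

Lemma Dxy_mulXn_uw A B f :
  Dxy ('X_iu ^+ A * 'X_iw ^+ B * f) = 'X_iu ^+ A * 'X_iw ^+ B * Dxy f.
Proof.
elim: A => [|A IH]; last by rewrite exprS -!mulrA Dxy_mulX !mulrA IH !mulrA.
rewrite expr0 !mul1r; elim: B => [|B IH]; first by rewrite expr0 !mul1r.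
by rewrite exprS -!mulrA Dxy_mulX IH.
Qed.

Lemma mderivu_iter_Dxy k f : mderiv iu f = 0 -> mderiv iu (iter k (@Dxy K m) f) = 0.
Proof. by move=> h; elim: k => //= k IH; rewrite mderiv_DxyE IH linear0. Qed.

Lemma mderivw_iter_Dxy k f : mderiv iw f = 0 -> mderiv iw (iter k (@Dxy K m) f) = 0.
Proof. by move=> h; elim: k => //= k IH; rewrite mderiv_DxyE IH linear0. Qed.

Lemma mderivu_mulXn_w B f : mderiv iu ('X_iw ^+ B * f) = 'X_iw ^+ B * mderiv iu f.
Proof.
elim: B => [|B IH]; first by rewrite expr0 !mul1r.
by rewrite exprS -!mulrA mderivu_mulX IH.
Qed.

Lemma mderivw_mulXn_u A f : mderiv iw ('X_iu ^+ A * f) = 'X_iu ^+ A * mderiv iw f.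
Proof.
elim: A => [|A IH]; first by rewrite expr0 !mul1r.
by rewrite exprS -!mulrA mderivw_mulX IH.
Qed.

Lemma mderivuw_monomial A B f : mderiv iu f = 0 -> mderiv iw f = 0 ->
  mderiv iu (mderiv iw ('X_iu ^+ A * 'X_iw ^+ B * f)) =
  (A%:R * B%:R) *: ('X_iu ^+ A.-1 * 'X_iw ^+ B.-1 * f).
Proof.
move=> fu fw; rewrite -mulrA mderivw_mulXn_u mderivXn_w // -scalerAr linearZ /=.
by rewrite mderivXn_u ?mderivu_mulXn_w ?fu ?mulr0 // scalerA mulrC mulrA.
Qed.

Lemma Delta_hlift N a b f : (a * b = 0)%N -> mderiv iu f = 0 -> mderiv iw f = 0 ->
  iter N (@Dxy K m) f = 0 -> Delta (hlift N a b f) = 0.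
Proof.
move=> ab fu fw fN.
(* d_u d_w maps the k-th term of the lift to [T k], and D maps it to [T k.+1], so the sum
   telescopes. [T 0] vanishes since a b = 0, and [T N] since [Dxy ^ N] kills [f]. *)
pose T k := (hlift_coef a b k * ((a + k)%:R * (b + k)%:R)) *:
  ('X_iu ^+ (a + k).-1 * 'X_iw ^+ (b + k).-1 * iter k (@Dxy K m) f) : V.
rewrite linear_sum /= (eq_bigr (fun k : 'I_N => T k - T k.+1)).
  rewrite -(big_mkord xpredT (fun k => T k - T k.+1)).
  rewrite (telescope_sumr_eq (fun k => - T k)) //.
    rewrite /T fN mulr0 scaler0 addn0 addn0 -natrM ab mulr0 scale0r oppr0 subr0 //.
  by move=> k _; rewrite opprK addrC.
move=> k _; rewrite linearZ /= DeltaE Dxy_mulXn_uw mderivuw_monomial.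
- by rewrite scalerBr scalerA /T hlift_coefS [(a + k.+1)%N]addnS [(b + k.+1)%N]addnS.
- exact: mderivu_iter_Dxy.
- exact: mderivw_iter_Dxy.
Qed.

(** All terms with k >= 1 are divisible by u w, and [hlift_coef a b 0] is 1. *)
Lemma hlift_boundary N a b f M : (0 < N)%N -> (M iu * M iw = 0)%N ->
  (hlift N a b f)@_M = ('X_iu ^+ a * 'X_iw ^+ b * f)@_M.
Proof.
case: N => // N _ Muw; rewrite /hlift big_ord_recl linearD /= !addn0 mcoeffZ.
rewrite /hlift_coef !addn0 mulfV ?mul1r; last first.
  by rewrite pnatr_eq0 -lt0n muln_gt0 !fact_gt0.
rewrite raddf_sum /= big1 ?addr0 // => k _.
rewrite mcoeffZ /bump /= add1n [(a + k.+1)%N]addnS [(b + k.+1)%N]addnS !exprS -!mulrA.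
move/eqP: Muw; rewrite muln_eq0 => /orP[/eqP Mu|/eqP Mw].
  by rewrite mcoeff_mulX0 ?mulr0.
rewrite [X in X@_M](_ : _ = 'X_iw * ('X_iu ^+ (a + k).+1 *
  ('X_iw ^+ (b + k) * iter k.+1 (@Dxy K m) f))).
  by rewrite mcoeff_mulX0 ?mulr0.
by rewrite exprS iterS; move: ('X_iu : V) ('X_iw : V) (Dxy _) => ? ? ?; ring.
Qed.

End Lift.

(** * Powers of a derivation through a generating polynomial *)

Section Flow.
Variables (A : comNzRingType) (D : {additive A -> A}).
Hypothesis D_M : forall f g, D (f * g) = D f * g + f * D g.

(* [D] acts on the coefficients of [Q] as d/dt. For [D = Dxy] the polynomial
   prod_i x_i^(a_i) (y_i + t x_i)^(b_i) has this property, so that the sum over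
   r_1, ..., r_(n-1) in [basis_poly] is a sum over the powers of [Dxy]. *)
Definition flow (Q : {poly A}) := forall k, D Q`_k = Q^`()`_k.

Lemma flow1 : flow 1.
Proof.
have D1 : D 1 = 0.
  by have := D_M 1 1; rewrite !mulr1 mul1r -[X in X = _]addr0 => /addrI.
by move=> k; rewrite -[1]polyC1 derivC coefC coef0; case: eqP; rewrite ?raddf0.
Qed.

Lemma flowM P Q : flow P -> flow Q -> flow (P * Q).
Proof.
move=> hP hQ k; rewrite derivM coefD !coefM raddf_sum -big_split /=.
by apply: eq_bigr => i _; rewrite D_M hP hQ.
Qed.

Lemma flow_prod (I : Type) (r : seq I) (F : I -> {poly A}) :
  (forall t, flow (F t)) -> flow (\prod_(t <- r) F t).
Proof.
by move=> h; elim/big_ind: _ => //; [exact: flow1 | exact: flowM].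
Qed.

(** Taylor's formula at t = 0. *)
Lemma flow_iter Q k : flow Q -> iter k D Q`_0 = Q`_k *+ k`!.
Proof.
move=> h; elim: k => [|k IH] //; rewrite iterS IH raddfMn h coef_deriv.
by rewrite -mulrnA factS.
Qed.

Lemma flow_poly N (F : nat -> A) : (forall r, D (F r) = F r.+1 *+ r.+1) ->
  F N.+1 = 0 -> flow (\poly_(r < N.+1) F r).
Proof.
move=> hF FN k; rewrite coef_deriv !coef_poly !ltnS.
case: ltngtP => kb; last by rewrite hF kb FN mul0rn.
- by rewrite hF.
- by rewrite raddf0 mul0rn.
Qed.

Lemma coef_prod_poly (I : finType) N (F : I -> nat -> A) k :
  (\prod_i \poly_(r < N) F i r)`_k =
  \sum_(r : {ffun I -> 'I_N} | (\sum_i r i == k)%N) \prod_i F i (r i).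
Proof.
under eq_bigr do rewrite poly_def.
rewrite bigA_distr_bigA coef_sum [RHS]big_mkcond; apply: eq_bigr => r _ /=.
rewrite scaler_prod -expr_sum coefZ coefXn eq_sym.
by case: eqP; rewrite ?mulr1 ?mulr0.
Qed.

Lemma coef0_prod_poly (I : finType) N (F : I -> nat -> A) :
  (\prod_i \poly_(r < N.+1) F i r)`_0 = \prod_i F i 0%N.
Proof.
rewrite -horner_coef0 horner_prod; apply: eq_bigr => i _.
by rewrite horner_coef0 coef_poly.
Qed.

End Flow.

(** * The given polynomials as lifts of monomials *)

Section Basis.
Variables (K : numFieldType) (m : nat).
Local Notation n := m.+2.
Local Notation V := {mpoly K[m.+2 + m.+2]}.
Implicit Types (f g p : V) (i j : 'I_m.+1) (a b : 'X_{1..m.+2}).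

Lemma Dxy_mulXn_x i N f : Dxy ('X_(ix i) ^+ N * f) = 'X_(ix i) ^+ N * Dxy f.
Proof.
elim: N => [|N IH]; first by rewrite expr0 !mul1r.
by rewrite exprS -!mulrA Dxy_mulX IH.
Qed.

Lemma Dxy_Xn_y i N :
  Dxy ('X_(iy i) ^+ N : V) = N%:R *: ('X_(ix i) * 'X_(iy i) ^+ N.-1).
Proof.
elim: N => [|N IH].
  by rewrite expr0 scale0r /Dxy big1 // => k _; rewrite -mpolyC1 mderivC mulr0.
rewrite exprS Dxy_mulX IH -[N.+1%:R]natr1 scalerDl scale1r; congr (_ + _).
rewrite -scalerAr; case: N {IH} => [|N]; first by rewrite !scale0r.
by rewrite exprS /= mulrCA.
Qed.

(** The coefficient of t^r in x_i^(a_i) (y_i + t x_i)^(b_i). *)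
Definition bin_factor a b i (r : nat) : V :=
  'C(b (idx_T i), r)%:R *:
    ('X_(ix i) ^+ (a (idx_T i) + r) * 'X_(iy i) ^+ (b (idx_T i) - r)).

Lemma Dxy_bin_factor a b i r :
  Dxy (bin_factor a b i r) = bin_factor a b i r.+1 *+ r.+1.
Proof.
rewrite /bin_factor linearZ /= Dxy_mulXn_x Dxy_Xn_y -scalerAr scalerA.
rewrite scalerMnl -mulrnA -natrM.
rewrite mulnC -mul_bin_left mulnC; congr (_ *: _).
by rewrite mulrA -exprSr [(a _ + r.+1)%N]addnS [(b _ - r.+1)%N]subnS.
Qed.

Definition bin_poly a b i : {poly V} :=
  \poly_(r < (mdeg b).+1) bin_factor a b i r.

Lemma le_mdeg b t : (b t <= mdeg b)%N.
Proof. by rewrite mdegE (bigD1 t) //= leq_addr. Qed.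

Lemma bin_poly_flow a b i : flow (@Dxy K m) (bin_poly a b i).
Proof.
apply: flow_poly; first exact: Dxy_bin_factor.
by rewrite /bin_factor bin_small ?scale0r // ltnS le_mdeg.
Qed.

Definition xyT a b : V := \prod_i ('X_(ix i) ^+ a (idx_T i) * 'X_(iy i) ^+ b (idx_T i)).

Definition big_poly a b : {poly V} := \prod_i bin_poly a b i.

Lemma big_poly0 a b : (big_poly a b)`_0 = xyT a b.
Proof.
rewrite /big_poly coef0_prod_poly; apply: eq_bigr => i _.
by rewrite /bin_factor bin0 scale1r addn0 subn0.
Qed.

Lemma big_poly_coef a b k :
  (big_poly a b)`_k =
  \sum_(r : {ffun 'I_m.+1 -> 'I_(mdeg b).+1} | (\sum_i r i == k)%N)
     \prod_i bin_factor a b i (r i).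
Proof. exact: coef_prod_poly. Qed.

Lemma iter_Dxy_xyT a b k :
  iter k (@Dxy K m) (xyT a b) = (big_poly a b)`_k *+ k`!.
Proof.
rewrite -big_poly0; apply: (flow_iter (D := @Dxy K m)).
apply: flow_prod => [f g|i]; [exact: Dxy_M | exact: bin_poly_flow].
Qed.

Lemma prod_bin_factor a b (r : {ffun 'I_m.+1 -> 'I_(mdeg b).+1}) :
  \prod_i bin_factor a b i (r i) =
  (\prod_i 'C(b (idx_T i), r i))%N%:R *:
  \prod_i ('X_(ix i) ^+ (a (idx_T i) + r i) * 'X_(iy i) ^+ (b (idx_T i) - r i)).
Proof. by rewrite natr_prod -scaler_prod. Qed.

(** The sum of m + 1 numbers r_i <= |b| stays below this bound, so no tuple is lost when tuples are
    grouped by their sum. *)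
Definition bnd b := (m.+1 * mdeg b).+1.

(** Grouping the tuples r by their sum k collects the coefficient of t^k in the generating
    polynomial; the factor (r_1 + ... + r_(n-1))! is the k! of [flow_iter]. *)
Lemma basis_polyE a b :
  basis_poly K a b = hlift (bnd b) (a idx_n) (b idx_n) (xyT a b).
Proof.
rewrite /hlift.
pose F k : V := hlift_coef K (a idx_n) (b idx_n) k *:
    ('X_iu ^+ (a idx_n + k) * 'X_iw ^+ (b idx_n + k)).
transitivity (\sum_(k < bnd b) F k * (big_poly a b)`_k *+ k`!); last first.
  apply: eq_bigr => k _.
  by rewrite iter_Dxy_xyT /F -scalerAl mulrnAr scalerMnr.
under [RHS]eq_bigr do rewrite big_poly_coef mulr_sumr -sumrMnl.
rewrite (exchange_big_dep predT) //=; apply: eq_bigr => r _.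
have hr : (\sum_i r i < bnd b)%N.
  have e : (\sum_(i < m.+1) mdeg b = m.+1 * mdeg b)%N.
    by rewrite sum_nat_const card_ord.
  rewrite ltnS -e; apply: leq_sum => i _.
  by rewrite -ltnS.
rewrite (big_pred1 (Ordinal hr)) => [|k]; last by rewrite /= eq_sym.
rewrite /= prod_bin_factor /F -scalerAl -scalerAr scalerA scalerMnl.
congr (_ *: _); rewrite /hlift_coef -mulr_natr !natrM.
by ring.
Qed.

End Basis.

(** * The basis of H *)

Section HarmonicBasis.
Variables (K : numFieldType) (m : nat).
Local Notation n := m.+2.
Local Notation V := {mpoly K[m.+2 + m.+2]}.
Implicit Types (f g p : V) (i j : 'I_m.+1) (a b : 'X_{1..m.+2}).
Local Notation inXY d e := (supp (bideg d e)).

Lemma inXY_inB d e p : inXY d e p -> inB (- d%:Z) e p.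
Proof.
have sZ (F : 'I_m.+1 -> nat) : \sum_i (F i)%:Z = (\sum_i F i)%N.
  by rewrite (big_morph Posz PoszD (erefl _)).
move=> h; split; apply: supp_impl h => M [hu hw hx hy].
  by rewrite wt1E hu sZ hx sub0r.
by rewrite wt2E hw sZ hy addr0.
Qed.

Lemma hlift_inB N (a b d e : nat) p : inXY d e p ->
  inB (a%:Z - d%:Z) (b%:Z + e%:Z) (hlift N a b p).
Proof.
move=> hp; apply: inB_sum => k _; apply: inBZ.
have [ke|ek] := leqP k e; last by rewrite (iter_Dxy0 hp ek) mulr0; exact: inB0.
have := inXY_inB (inXY_iter_Dxy hp ke).
move/(inB_mulXn iw (b + k))/(inB_mulXn iu (a + k)).
rewrite /wt1 /wt2 !var_wtE !mulr0 !mulr1 !addr0 mulrA -subzn // !PoszD.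
by congr inB; ring.
Qed.

Lemma Hsp_hlift N (a b d e : nat) (l1 : int) (l2 : nat) p : (a * b = 0)%N -> inXY d e p -> (e < N)%N ->
  a%:Z - d%:Z = l1 -> (b + e)%N = l2 -> Hsp l1 l2 (hlift N a b p).
Proof.
move=> ab hp eN <- <-; apply/HspP; split; first by rewrite PoszD; exact: hlift_inB.
apply: Delta_hlift => //; [exact: inXY_du hp | exact: inXY_dw hp|].
exact: iter_Dxy0 hp eN.
Qed.

Lemma monomial_xyT a b :
  'X_[mjoin a b] = 'X_iu ^+ a idx_n * 'X_iw ^+ b idx_n * xyT K a b.
Proof.
have prod_idx (F : 'I_n -> V) : \prod_k F k = \prod_i F (idx_T i) * F idx_n.
  exact: big_ord_recr.
by rewrite -xymonE /xymon !prod_idx mulrACA mulrC /xyT big_split.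
Qed.

Definition mnmT a : 'X_{1..n} := [multinom if k == idx_n then 0%N else a k | k < n].

Lemma mnmTT a i : mnmT a (idx_T i) = a (idx_T i).
Proof. by rewrite mnmE idx_T_neq. Qed.

Lemma mnmTn a : mnmT a idx_n = 0%N.
Proof. by rewrite mnmE eqxx. Qed.

Lemma xyT_monomial a b : xyT K a b = 'X_[mjoin (mnmT a) (mnmT b)].
Proof.
rewrite monomial_xyT !mnmTn !expr0 !mul1r; apply: eq_bigr => i _.
by rewrite !mnmTT.
Qed.

Lemma inXY_xyT a b :
  inXY (\sum_i a (idx_T i)) (\sum_i b (idx_T i)) (xyT K a b).
Proof.
rewrite xyT_monomial; apply: suppX; split; rewrite ?mjoinE ?mnmTn //.
  by apply: eq_bigr => i _; rewrite mjoinE mnmTT.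
by apply: eq_bigr => i _; rewrite mjoinE mnmTT.
Qed.

(** Duality with the monomials not divisible by u w: independence follows at once, and the
    coefficients in an expansion are boundary coefficients. *)
Lemma basis_poly_boundary a b (M : 'X_{1..n + n}) : (M iu * M iw = 0)%N ->
  (basis_poly K a b)@_M = (mjoin a b == M)%:R.
Proof.
by move=> hM; rewrite basis_polyE hlift_boundary // -monomial_xyT mcoeffX.
Qed.

Lemma basis_poly_Hsp l1 l2 (ab : 'X_{1..n} * 'X_{1..n}) :
  basis_index l1 l2 ab -> Hsp l1 l2 (basis_poly K ab.1 ab.2).
Proof.
case=> ab0 h1 h2; rewrite basis_polyE.
apply: (Hsp_hlift ab0 (@inXY_xyT _ _)).
- rewrite ltnS mdegE sum_idx mulSn -addnA; exact: leq_addr.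
- by rewrite -h1 (big_morph Posz PoszD (erefl _)).
- by rewrite -h2 sum_idx addnC.
Qed.

Lemma mjoin_inj a b a' b' : mjoin a b = mjoin a' b' -> a = a' /\ b = b'.
Proof.
move=> e; split; apply/mnmP => k.
  by have := congr1 (fun M : 'X_{1..n + n} => M (lshift n k)) e; rewrite !mjoinE.
by have := congr1 (fun M : 'X_{1..n + n} => M (rshift n k)) e; rewrite !mjoinE.
Qed.

Definition mnml (M : 'X_{1..n + n}) : 'X_{1..n} := [multinom M (lshift n k) | k < n].
Definition mnmr (M : 'X_{1..n + n}) : 'X_{1..n} := [multinom M (rshift n k) | k < n].

Lemma basis_index_mnm l1 (l2 : nat) (M : 'X_{1..n + n}) :
  wt (@wt1 m) M = l1 -> wt (@wt2 m) M = l2 -> (M iu * M iw = 0)%N ->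
  basis_index l1 l2 (mnml M, mnmr M).
Proof.
rewrite wt1E wt2E => <- h2 h0; split; rewrite /= ?mnmE //.
  by congr (_ - _); apply: eq_bigr => i _; rewrite mnmE.
apply/eqP; rewrite -eqz_nat -h2 sum_idx PoszD mnmE.
rewrite (big_morph Posz PoszD (erefl _)) /=; apply/eqP; congr (_ + _).
by apply: eq_bigr => i _; rewrite mnmE.
Qed.

(** The difference of the two sides is harmonic and has no boundary monomial, so
    [ker_Delta_determined] applies. *)
Lemma Hsp_expansion l1 l2 f : Hsp l1 l2 f ->
  f = \sum_(M <- msupp f | (M iu * M iw == 0)%N)
        f@_M *: basis_poly K (mnml M) (mnmr M).
Proof.
move=> /HspP[[h1 h2] Df]; apply/eqP; rewrite -subr_eq0; apply/eqP.
apply: ker_Delta_determined => [|M hM].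
  rewrite linearB /= Df linear_sum big_seq_cond big1 ?subr0 // => M.
  rewrite mcoeff_msupp => /andP[hM /eqP M0].
  have [_] := basis_poly_Hsp (basis_index_mnm (h1 _ hM) (h2 _ hM) M0).
  by rewrite linearZ /= => ->; rewrite scaler0.
rewrite mcoeffB raddf_sum /=.
under eq_bigr => M' hM' do rewrite mcoeffZ basis_poly_boundary // -mjoin_split.
have [hs|hs] := boolP (M \in msupp f); last first.
  rewrite (memN_msupp_eq0 hs) big_seq_cond big1 ?subr0 // => M' /andP[hM' _].
  by case: eqP => [e|]; rewrite ?mulr0 //; move: hs; rewrite -e hM'.
rewrite -big_filter (bigD1_seq M) ?filter_uniq ?mem_filter ?hM //=.
rewrite eqxx mulr1 big1 ?addr0 ?subrr // => M' /negbTE ->.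
by rewrite mulr0.
Qed.

Lemma Hsp_basis l1 l2 :
  basis_of_family (basis_index l1 l2)
    (fun ab : 'X_{1..n} * 'X_{1..n} => basis_poly K ab.1 ab.2) (@Hsp K m l1 l2).
Proof.
split=> [s c us hs h0 ab hab|f].
  have [hab0 _ _] := hs _ hab.
  have := congr1 (mcoeff (mjoin ab.1 ab.2)) h0; rewrite mcoeff0 raddf_sum /=.
  rewrite (bigD1_seq ab) //= mcoeffZ basis_poly_boundary ?mjoinE // eqxx mulr1.
  rewrite big1 ?addr0 // => ab' ne.
  rewrite mcoeffZ basis_poly_boundary ?mjoinE //; case: eqP => [|_]; last by rewrite mulr0.
  case/mjoin_inj => e1 e2; move: ne; rewrite -pair_eqE /pair_eq e1 e2 !eqxx //.
have [N0 Nlin _] := Hsp_submodule K m l1 l2.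
split=> [hf|[s [hs ->]]]; last first.
  rewrite big_seq; elim/big_ind: _ => //.
    by move=> u v hu hv; rewrite -[u]scale1r; exact: Nlin.
  move=> cu /hs[ab hab ->]; rewrite -[_ *: _]addr0; apply: Nlin => //.
  exact: basis_poly_Hsp.
rewrite (Hsp_expansion hf); have /HspP[[h1 h2] _] := hf.
exists [seq (f@_M, basis_poly K (mnml M) (mnmr M)) |
  M : 'X_{1..n + n} <- [seq M : 'X_{1..n + n} <- msupp f | (M iu * M iw == 0)%N]]; split; last first.
  by rewrite [RHS]big_map [RHS]big_filter.
move=> cu /mapP[M]; rewrite mem_filter mcoeff_msupp => /andP[/eqP M0 hM] ->.
by exists (mnml M, mnmr M) => //; apply: basis_index_mnm; [exact: h1|exact: h2|].
Qed.

End HarmonicBasis.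

Lemma sum_delta_mx (K : nzRingType) (W : lmodType K) n (F : 'I_n -> 'I_n -> W) a b :
  \sum_i \sum_j (delta_mx a b : 'M[K]_n) i j *: F i j = F a b.
Proof.
rewrite (bigD1 a) //= (bigD1 b) //= mxE !eqxx scale1r.
rewrite big1 ?addr0 => [|k /negbTE kb]; last by rewrite mxE kb andbF scale0r.
rewrite big1 ?addr0 // => k /negbTE ka; rewrite big1 // => l _.
by rewrite mxE ka scale0r.
Qed.

(** * Singular vectors *)

Section Singular.
Variables (K : numFieldType) (m : nat).
Local Notation n := m.+2.
Local Notation V := {mpoly K[m.+2 + m.+2]}.
Implicit Types (f g : V) (i j : 'I_m.+1) (M : 'X_{1..m.+2 + m.+2}).

Lemma act_delta (a b : 'I_n) f : act (Sn m) (delta_mx a b) f = actE (Sn m) a b f.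
Proof. exact: sum_delta_mx. Qed.

(** Off-diagonal matrix units have trace zero; the diagonal ones lie outside sl(n). *)
Lemma submodule_actE (N : V -> Prop) (a b : 'I_n) f : submodule (Sn m) N ->
  a != b -> N f -> N (actE (Sn m) a b f).
Proof.
case=> _ _ hN ab /(hN (delta_mx a b)); rewrite act_delta; apply.
rewrite /mxtrace big1 // => k _; rewrite mxE.
by have [->|] := eqVneq k a; rewrite ?(negbTE ab).
Qed.

(** The values decrease along T because E_(i,j) turns x_i into x_j and y_i into y_j. The value 1 for
    u and the extra 1 for y_i make d_(x_i) d_u and w d_(y_i) lower the height as well, even for i =
    s. *)
Definition height : 'I_(n + n) -> int :=
  var_wt (fun i => m%:Z - i%:Z) 1 (fun i => m%:Z - i%:Z + 1) 0.

Local Notation below k := (supp (fun M => wt height M < k)).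

Lemma below_mulX k l t f : below k f -> k + height t <= l -> below l ('X_t * f).
Proof.
move=> hf kl; apply: supp_mulXm hf => M hM; rewrite wtD wtU.
by apply: lt_le_trans kl; rewrite addrC ltrD2r.
Qed.

Lemma below_mderiv k l t f : below k f -> k - height t <= l ->
  below l (mderiv t f).
Proof.
move=> hf kl; apply: supp_mderiv hf => M; rewrite wtD wtU => hM.
by apply: lt_le_trans kl; rewrite ltrBrDr.
Qed.

Lemma below_actE (a b : 'I_n) k f : (a < b)%N ->
  below (k + 1) f -> below k (actE (Sn m) a b f).
Proof.
have hX i : height (ix i) = m%:Z - i%:Z by rewrite /height var_wtE.
have hU : height iu = 1 by rewrite /height var_wtE.
have hY i : height (iy i) = m%:Z - i%:Z + 1 by rewrite /height var_wtE.
have hW : height iw = 0 by rewrite /height var_wtE.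
case: (idxP a) => [i|]; case: (idxP b) => [j|] /= ab hf; rewrite actEE.
- have -> : (i == j) = false by apply/eqP => e; move: ab; rewrite e ltnn.
  rewrite mul0r subr0; apply: suppB; first apply: suppN.
    apply: below_mulX; first exact: below_mderiv hf (lexx _).
    by rewrite !hX; lia.
  apply: below_mulX; first exact: below_mderiv hf (lexx _).
  by rewrite !hY; lia.
- have im := ltn_ord i; apply: suppB.
    apply: below_mderiv; first exact: below_mderiv hf (lexx _).
    by rewrite hX hU; lia.
  apply: below_mulX; first exact: below_mderiv hf (lexx _).
  by rewrite hY hW; lia.
- by move: ab (ltn_ord j); rewrite ltnNge => /negP ab jm; case: ab; exact: ltnW.
- by rewrite ltnn in ab.
Qed.

Lemma height_ge0 t : 0 <= height t.
Proof.
rewrite /height; case: (varP t) => [i||i|]; rewrite var_wtE //;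
  by have := ltn_ord i; lia.
Qed.

Lemma wt_height_ge0 M : 0 <= wt height M.
Proof. by apply: sumr_ge0 => t _; rewrite mulr_ge0 ?height_ge0. Qed.

Definition singular f := forall a b : 'I_n, (a < b)%N -> actE (Sn m) a b f = 0.

Lemma submodule_singular (N : V -> Prop) f : submodule (Sn m) N -> N f ->
  f != 0 -> exists g, [/\ N g, g != 0 & singular g].
Proof.
move=> sN; have [k] : exists k : nat, below k%:Z f.
  exists (\sum_(M <- msupp f) `|wt height M|).+1 => M.
  rewrite -mcoeff_msupp => hM; rewrite (big_rem _ hM) /=.
  by have := wt_height_ge0 M; lia.
elim: k f => [|k IH] f hk Nf f0.
  case/eqP: f0; apply/mpolyP => M; rewrite mcoeff0; apply/eqP.
  by apply/negP => /negP /hk; rewrite ltNge wt_height_ge0.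
have [/existsP[a /existsP[b /andP[ab E0]]]|] :=
  boolP [exists a : 'I_n, exists b : 'I_n, (a < b)%N && (actE (Sn m) a b f != 0)].
  apply: (IH (actE (Sn m) a b f)) => //.
    by apply: below_actE => //; move: hk; rewrite -[k.+1]addn1 PoszD.
  by apply: submodule_actE => //; rewrite -val_eqE /= ltn_eqF.
move=> hs; exists f; split=> // a b ab; apply/eqP.
by move: hs; rewrite negb_exists => /forallP/(_ a);
   rewrite negb_exists => /forallP/(_ b); rewrite ab /= negbK.
Qed.

Lemma mcoeff_mulX_mderiv_shift s t f M : (M t != 0)%N ->
  ('X_s * mderiv t f)@_(U_(s) + (M - U_(t))) = f@_M *+ M t.
Proof.
move=> Mt; rewrite mcoeff_mulX mcoeff_mderiv submK ?lep1mP //.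
by rewrite mnmBE mnm1E eqxx subn1 prednK // lt0n.
Qed.

(* Summing x_i E_(i,n) f over T and using [Delta f = 0]. *)
Lemma singular_mnm_u f M : Delta f = 0 -> singular f -> f@_M != 0 ->
  M iu != 0%N -> (\sum_i M (ix i) = M iw)%N.
Proof.
move=> Df sf fM Mu.
have e : Eul_x (mderiv iu f) = 'X_iw * mderiv iw (mderiv iu f).
  have : \sum_i 'X_(ix i) * actE (Sn m) (idx_T i) idx_n f = 0.
    by rewrite big1 // => i _; rewrite sf ?mulr0 //=.
  under eq_bigr do rewrite actETn mulrBr mulrCA.
  rewrite sumrB -mulr_sumr => /eqP; rewrite subr_eq0 /Eul_x => /eqP ->.
  rewrite -/(Dxy f).
  have : Delta f = 0 by [].
  rewrite DeltaE => /eqP; rewrite subr_eq0 => /eqP <-.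
  by rewrite mderiv_comm.
have EM : (M - U_(iu) + U_(iu))%MM = M by rewrite submK // lep1mP.
have := congr1 (mcoeff (M - U_(iu))%MM) e.
rewrite mcoeff_mulX_mderiv raddf_sum /=.
under eq_bigr do rewrite mcoeff_mulX_mderiv.
rewrite -mulr_suml -natr_sum => /mulIf h.
have d0 : (mderiv iu f)@_(M - U_(iu)) != 0 by rewrite mcoeff_mderiv EM mulrn_eq0.
have /eqP := h d0; rewrite eqr_nat mnmBE mnm1E var_eqE subn0 => /eqP <-.
by apply: eq_bigr => i _; rewrite mnmBE mnm1E var_eqE subn0.
Qed.

Section LowCase.
Variables (l1 : int) (l2 : nat).
Hypothesis hl : l1 + l2%:Z <= 0.

Definition low_mnm : 'X_{1..n + n} :=
  mjoin (U_(idx_s) *+ `|- l1|)%MM (U_(idx_n) *+ l2)%MM.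

Lemma wt1_nat M l : wt (@wt1 m) M = l ->
  (M iu)%:Z - (\sum_i M (ix i))%N%:Z = l.
Proof. by rewrite wt1E (big_morph Posz PoszD (erefl _)). Qed.

Lemma wt2_nat M (l : nat) : wt (@wt2 m) M = l ->
  (\sum_i M (iy i) + M iw)%N = l.
Proof.
by rewrite wt2E -(big_morph Posz PoszD (erefl _)) -PoszD => -[].
Qed.

Lemma singular_low f : Hsp l1 l2 f -> singular f ->
  f = f@_low_mnm *: 'X_[low_mnm].
Proof.
move=> /HspP[[h1 h2] Df] sf.
(* If u occurred, the degree in the x_i would equal the exponent of w, hence be at most l_2; but it
   exceeds -l_1 >= l_2. *)
have S2 M : f@_M != 0 -> M iu = 0%N.
  move=> fM; apply/eqP/negPn/negP => Mu.
  have := singular_mnm_u Df sf fM Mu.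
  have := wt1_nat (h1 _ fM); have := wt2_nat (h2 _ fM).
  by move=> e2 e1 e3; rewrite e3 in e1; lia.
(* In the coefficient of w M / y_i in E_(i,n) f, the term d_(x_i) d_u would come from a monomial
   containing u, which [S2] excludes. *)
have S3 M i : f@_M != 0 -> M (iy i) = 0%N.
  move=> fM; apply/eqP/negPn/negP => My.
  have := congr1 (mcoeff (U_(iw) + (M - U_(iy i)))%MM) (sf (idx_T i) idx_n (ltn_ord i)).
  rewrite actETn mcoeffB mcoeff_mulX_mderiv_shift // mcoeff0 !mcoeff_mderiv.
  set M' := (_ + U_(iu))%MM; have [->|/S2] := eqVneq f@_M' 0.
    by rewrite !mul0rn sub0r => /eqP; rewrite oppr_eq0 mulrn_eq0 (negbTE fM) (negbTE My).
  by rewrite /M' !mnmDE !mnm1E eqxx !addn1.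
(* In the coefficient of x_s M / x_i in E_(i,s) f, the term y_s d_(y_i) does not contribute: by [S3]
   this monomial contains no y_s. *)
have S4 M i : f@_M != 0 -> i != ord_max -> M (ix i) = 0%N.
  move=> fM im; apply/eqP/negPn/negP => Mx.
  have ilt : (idx_T i < @idx_s m)%N.
    by rewrite /= ltn_neqAle -ltnS ltn_ord andbT.
  have := congr1 (mcoeff (U_(ix ord_max) + (M - U_(ix i)))%MM) (sf _ _ ilt).
  rewrite actETT (negbTE im) mul0r subr0 mcoeffB mcoeffN.
  rewrite mcoeff_mulX_mderiv_shift // mcoeff_mulX0.
    by move/eqP; rewrite mcoeff0 subr0 oppr_eq0 mulrn_eq0 (negbTE fM) (negbTE Mx).
  by rewrite mnmDE mnmBE !mnm1E !var_eqE subn0 S3.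
apply/mpolyP => M; rewrite mcoeffZ mcoeffX.
have [<-|ne] := eqVneq; first by rewrite mulr1.
rewrite mulr0; apply/eqP; apply: contraNT ne => fM; apply/eqP.
have := wt1_nat (h1 _ fM); have := wt2_nat (h2 _ fM).
rewrite (S2 _ fM) big1 ?add0n => [e2|i _]; last exact: S3.
rewrite (bigD1 ord_max) //= big1 => [|i im]; last exact: S4.
rewrite addn0 => e1; apply: mnm_varP => [i||i|]; rewrite mjoinE mulmnE mnm1E.
- rewrite idx_T_eq eq_sym; have [->|im] := eqVneq i ord_max; last by rewrite S4 // mul0n.
  by lia.
- by rewrite idx_T_neq mul0n S2.
- by rewrite idx_n_neq S3.
- by rewrite eqxx mul1n.
Qed.

End LowCase.

Section HighCase.
Variables (l1 : int) (l2 : nat).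
Hypothesis hl : 0 < l1.

Definition high_x : 'X_{1..n} := (U_(idx_n) *+ `|l1|)%MM.
Definition high_y : 'X_{1..n} := (U_(idx_s) *+ l2)%MM.

Lemma basis_index_high : basis_index l1 l2 (high_x, high_y).
Proof.
split=> /=.
- by rewrite !mulmnE !mnm1E idx_T_neq !mul0n muln0.
- rewrite big1 => [|i _]; last by rewrite mulmnE mnm1E idx_n_neq.
  by rewrite mulmnE mnm1E eqxx mul1n subr0 gtz0_abs.
- by rewrite -mdegE mdegMn mdeg1 mul1n.
Qed.

Lemma singular_high f : Hsp l1 l2 f -> singular f ->
  f = f@_(mjoin high_x high_y) *: basis_poly K high_x high_y.
Proof.
move=> hf sf; have /HspP[[h1 h2] Df] := hf.
have [b0 _ _] := basis_index_high.
have [_ Db] := basis_poly_Hsp K basis_index_high.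
apply/eqP; rewrite -subr_eq0; apply/eqP; apply: ker_Delta_determined.
  by rewrite linearB linearZ /= Df Db scaler0 subr0.
move=> M hM; rewrite mcoeffB mcoeffZ basis_poly_boundary //.
have [<-|ne] := eqVneq; first by rewrite mulr1 subrr.
rewrite mulr0 subr0; apply/eqP; apply: contraNT ne => fM; apply/eqP.
have e1 := wt1_nat (h1 _ fM); have e2 := wt2_nat (h2 _ fM).
(* As l_1 > 0, u occurs; on the boundary w is then absent, and [singular_mnm_u] excludes all x_i. *)
have Mu : M iu != 0%N by lia.
have Mw : M iw = 0%N by move/eqP: hM; rewrite muln_eq0 (negbTE Mu) => /eqP.
have := singular_mnm_u Df sf fM Mu; rewrite Mw => Mx0.
have Mx i : M (ix i) = 0%N := sum_nat0 i Mx0.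
have My i : i != ord_max -> M (iy i) = 0%N.
  move=> im; apply/eqP/negPn/negP => My.
  have ilt : (idx_T i < @idx_s m)%N.
    by rewrite /= ltn_neqAle -ltnS ltn_ord andbT.
  have := congr1 (mcoeff (U_(iy ord_max) + (M - U_(iy i)))%MM) (sf _ _ ilt).
  rewrite actETT (negbTE im) mul0r subr0 mcoeffB mcoeffN.
  rewrite mcoeff_mulX_mderiv_shift // mcoeff_mulX0.
    by move/eqP; rewrite mcoeff0 oppr0 sub0r oppr_eq0 mulrn_eq0 (negbTE fM) (negbTE My).
  by rewrite mnmDE mnmBE !mnm1E !var_eqE subn0 Mx.
rewrite Mx0 subr0 in e1.
move: e2; rewrite (bigD1 ord_max) //= big1 => [|i im]; last exact: My.
rewrite Mw !addn0 => e2; apply: mnm_varP => [i||i|]; rewrite mjoinE mulmnE mnm1E.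
- by rewrite idx_n_neq Mx.
- by rewrite eqxx mul1n; lia.
- rewrite idx_T_eq eq_sym; have [->|im] := eqVneq i ord_max; last by rewrite My // mul0n.
  by rewrite mul1n.
- by rewrite idx_T_neq Mw.
Qed.

End HighCase.

End Singular.

(** * Root vectors acting on boundary values *)

Section BoundaryCongruence.
Variables (K : numFieldType) (m : nat).
Local Notation n := m.+2.
Local Notation V := {mpoly K[m.+2 + m.+2]}.
Implicit Types (f g p : V) (i j : 'I_m.+1) (M : 'X_{1..m.+2 + m.+2}).
Local Notation inXY d e := (supp (bideg d e)).

(* Congruence modulo the ideal generated by u w. *)
Definition eqb f g := forall M, (M iu * M iw = 0)%N -> f@_M = g@_M.

Lemma eqb_trans g f h : eqb f g -> eqb g h -> eqb f h.
Proof. by move=> hf hg M hM; rewrite hf ?hg. Qed.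

Lemma eqbD f g f' g' : eqb f g -> eqb f' g' -> eqb (f + f') (g + g').
Proof. by move=> h h' M hM; rewrite !mcoeffD h ?h'. Qed.

Lemma eqbN f g : eqb f g -> eqb (- f) (- g).
Proof. by move=> h M hM; rewrite !mcoeffN h. Qed.

Lemma eqbB f g f' g' : eqb f g -> eqb f' g' -> eqb (f - f') (g - g').
Proof. by move=> h /eqbN; exact: eqbD. Qed.

Lemma eqb_mulX k f g : eqb f g -> eqb ('X_k * f) ('X_k * g).
Proof.
move=> h M hM; have [Mk|Mk] := eqVneq (M k) 0%N; first by rewrite !mcoeff_mulX0.
have -> : M = (U_(k) + (M - U_(k)))%MM by rewrite addmC submK // lep1mP.
rewrite !mcoeff_mulX h // !mnmBE; apply/eqP; rewrite -leqn0 -hM.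
by rewrite leq_mul ?leq_subr.
Qed.

(** Derivatives in x_i and y_i preserve the ideal of u w, while d_w does not; this is why
    [mderivw_hlift_low] and [mderivw_hlift_high] look inside the lift. *)
Lemma eqb_mderiv_x i f g : eqb f g -> eqb (mderiv (ix i) f) (mderiv (ix i) g).
Proof.
by move=> h M hM; rewrite !mcoeff_mderiv h // !mnmDE !mnm1E !var_eqE !addn0.
Qed.

Lemma eqb_mderiv_y i f g : eqb f g -> eqb (mderiv (iy i) f) (mderiv (iy i) g).
Proof.
by move=> h M hM; rewrite !mcoeff_mderiv h // !mnmDE !mnm1E !var_eqE !addn0.
Qed.

Lemma eqb_uw f : eqb ('X_iu * ('X_iw * f)) 0.
Proof.
move=> M /eqP; rewrite mcoeff0 muln_eq0 => /orP[]/eqP h.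
  by rewrite mcoeff_mulX0.
by rewrite mulrCA mcoeff_mulX0.
Qed.

Lemma hlift_eqb N a b f : (0 < N)%N ->
  eqb (hlift N a b f) ('X_iu ^+ a * 'X_iw ^+ b * f).
Proof. by move=> N0 M; exact: hlift_boundary. Qed.

(** Since root vectors commute with [Delta], their action on lifts can be computed modulo u w and
    recovered by this lemma. *)
Lemma hlift_unique N (a b d e : nat) f p : (a * b = 0)%N -> inXY d e p ->
  (e < N)%N -> Delta f = 0 -> eqb f ('X_iu ^+ a * 'X_iw ^+ b * p) ->
  f = hlift N a b p.
Proof.
move=> ab hp eN Df hf; apply/eqP; rewrite -subr_eq0; apply/eqP.
apply: ker_Delta_determined => [|M hM].
  rewrite linearB /= Df Delta_hlift ?subr0 //.
  - exact: inXY_du hp.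
  - exact: inXY_dw hp.
  - exact: iter_Dxy0 hp eN.
by rewrite mcoeffB hf // hlift_boundary ?subrr // (leq_ltn_trans _ eN).
Qed.

Lemma Delta_hlift_inXY N (a b d e : nat) p : (a * b = 0)%N -> inXY d e p ->
  (e < N)%N -> Delta (hlift N a b p) = 0.
Proof.
move=> ab hp eN; apply: Delta_hlift => //; [exact: inXY_du hp | exact: inXY_dw hp|].
exact: iter_Dxy0 hp eN.
Qed.

Lemma hlift_change N N' (a b d e : nat) p : (a * b = 0)%N -> inXY d e p ->
  (e < N)%N -> (e < N')%N -> hlift N a b p = hlift N' a b p.
Proof.
move=> ab hp eN eN'; apply: (hlift_unique ab hp eN').
  exact: Delta_hlift_inXY hp eN.
by apply: hlift_eqb; exact: leq_ltn_trans eN.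
Qed.

Lemma actETT_mulXn_uw i j A B f :
  actE (Sn m) (idx_T i) (idx_T j) ('X_iu ^+ A * 'X_iw ^+ B * f) =
  'X_iu ^+ A * 'X_iw ^+ B * actE (Sn m) (idx_T i) (idx_T j) f.
Proof.
have dXn (z k : 'I_(n + n)) C g : k != z ->
    mderiv k ('X_z ^+ C * g) = 'X_z ^+ C * mderiv k g.
  move=> kz; elim: C => [|C IH]; first by rewrite expr0 !mul1r.
  by rewrite exprS -!mulrA mderiv_mulX (negbTE kz) mul0r add0r IH.
rewrite !actETT -!mulrA !dXn ?var_eqE //.
by move: (_ ^+ A) (_ ^+ B) ('X_(ix j) : V) ('X_(iy j) : V) ((_ == _)%:R : V)
   (mderiv _ _) (mderiv _ _) => *; ring.
Qed.

Lemma inXY_actETT i j d e p : inXY d e p ->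
  inXY d e (actE (Sn m) (idx_T i) (idx_T j) p).
Proof.
move=> hp; rewrite actETT; apply: suppB; [apply: suppB|].
- apply: suppN; case: d hp => [|d] hp; last exact/inXY_mulx/inXY_dx.
  rewrite mderiv_eq0 ?mulr0; first exact: supp0.
  by apply: supp_impl hp => M [_ _ h _]; apply: (sum_nat0 _ h).
- by rewrite mulr_natl -scaler_nat; exact: suppZ.
case: e hp => [|e] hp; last exact/inXY_muly/inXY_dy.
rewrite mderiv_eq0 ?mulr0; first exact: supp0.
by apply: supp_impl hp => M [_ _ _ h]; apply: (sum_nat0 _ h).
Qed.

Lemma actETT_hlift i j N (a b d e : nat) p : (a * b = 0)%N -> inXY d e p ->
  (e < N)%N ->
  actE (Sn m) (idx_T i) (idx_T j) (hlift N a b p) =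
  hlift N a b (actE (Sn m) (idx_T i) (idx_T j) p).
Proof.
move=> ab hp eN; apply: (hlift_unique ab (@inXY_actETT i j _ _ _ hp) eN).
  by rewrite Delta_actE (Delta_hlift_inXY ab hp eN) linear0.
rewrite -actETT_mulXn_uw; have h := hlift_eqb a b p (leq_ltn_trans (leq0n e) eN).
rewrite !actETT; apply: eqbB; [apply: eqbB|].
- exact/eqbN/eqb_mulX/eqb_mderiv_x.
- by move=> M hM; rewrite !mulr_natl !mcoeffMn h.
- exact/eqb_mulX/eqb_mderiv_y.
Qed.

Lemma mderivw_hlift N (a b : nat) p : mderiv iw p = 0 ->
  mderiv iw (hlift N a b p) = \sum_(k < N) (hlift_coef K a b k * (b + k)%:R) *:
    ('X_iu ^+ (a + k) * ('X_iw ^+ (b + k).-1 * iter k (@Dxy K m) p)).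
Proof.
move=> hp; rewrite linear_sum; apply: eq_bigr => k _.
rewrite linearZ /= -mulrA mderivw_mulXn_u mderivXn_w; last exact: mderivw_iter_Dxy.
by rewrite -scalerAr scalerA.
Qed.

Lemma eqb0D f g h : eqb f g -> eqb h 0 -> eqb (f + h) g.
Proof. by move=> hf hh M hM; rewrite mcoeffD hf ?hh ?mcoeff0 ?addr0. Qed.

Lemma eqb0_sum (I : Type) (r : seq I) (P : pred I) (F : I -> V) :
  (forall t, P t -> eqb (F t) 0) -> eqb (\sum_(t <- r | P t) F t) 0.
Proof.
by move=> h M hM; rewrite raddf_sum mcoeff0 big1 // => t Pt /=;
   rewrite h // mcoeff0.
Qed.

Lemma eqb_uw_exp A B c f : eqb (c *: ('X_iu ^+ A.+1 * ('X_iw ^+ B.+1 * f))) 0.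
Proof.
move=> M hM; rewrite mcoeffZ !exprS -!mulrA.
have -> : 'X_iu * ('X_iu ^+ A * ('X_iw * ('X_iw ^+ B * f))) =
  'X_iu * ('X_iw * ('X_iu ^+ A * ('X_iw ^+ B * f))).
  by congr (_ * _); rewrite mulrCA.
by rewrite eqb_uw ?mcoeff0 ?mulr0.
Qed.

Lemma mderivw_hlift_low N b p : mderiv iw p = 0 -> (0 < N)%N ->
  eqb (mderiv iw (hlift N 0 b.+1 p)) (b.+1%:R *: ('X_iw ^+ b * p)).
Proof.
case: N => // N hp _; rewrite mderivw_hlift // big_ord_recl; apply: eqb0D.
  move=> M _; rewrite /hlift_coef !addn0 /= expr0 mul1r divff ?mul1r //.
  by rewrite pnatr_eq0 -lt0n muln_gt0 !fact_gt0.
by apply: eqb0_sum => k _; rewrite lift0 add0n [(b.+1 + _)%N]addSn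
  [(b + _)%N]addnS; exact: eqb_uw_exp.
Qed.

(** With b = 0 the term k = 0 contains no w, while the term k = 1 loses its only w and reaches the
    boundary with coefficient a! / (a + 1)!. The index [N.+2] ensures that this term is present. *)
Lemma mderivw_hlift_high N a p : mderiv iw p = 0 ->
  eqb (mderiv iw (hlift N.+2 a 0 p)) (a.+1%:R^-1 *: ('X_iu ^+ a.+1 * Dxy p)).
Proof.
move=> hp; rewrite mderivw_hlift // big_ord_recl mulr0 scale0r add0r.
rewrite big_ord_recl; apply: eqb0D.
  move=> M _; congr (_@_M); rewrite /bump /= !addn0 add0n addn1 mul1r mulr1.
  congr (_ *: _); rewrite /hlift_coef addn1 add0n factS fact0 !muln1 natrM.
  by rewrite invfM mulrCA divff ?mulr1 // pnatr_eq0 -lt0n fact_gt0.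
apply: eqb0_sum => k _; rewrite !lift0 add0n [(a + _)%N]addnS.
exact: eqb_uw_exp.
Qed.

Lemma actEnT_hlift_low N j (b d e : nat) p : inXY d e p -> (e.+1 < N)%N ->
  actE (Sn m) idx_n (idx_T j) (hlift N 0 b.+1 p) =
  hlift N 0 b (- (b.+1%:R *: ('X_(iy j) * p))).
Proof.
move=> hp eN; have eN' := ltnW eN; have N0 := leq_ltn_trans (leq0n e) eN'.
have hy : inXY d e.+1 (- (b.+1%:R *: ('X_(iy j) * p))).
  by apply: suppN; apply: suppZ; exact: inXY_muly.
apply: (hlift_unique _ hy) => //.
  by rewrite Delta_actE (Delta_hlift_inXY _ hp) ?linear0.
rewrite actEnT expr0 mul1r mulrN -[X in eqb _ X]sub0r; apply: eqbB.
  rewrite -oppr0; apply: eqbN; rewrite -mulrA mulrCA.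
  apply: (@eqb_trans ('X_(ix j) * ('X_iu * ('X_iu ^+ 0 * 'X_iw ^+ b.+1 * p)))).
    exact/eqb_mulX/eqb_mulX/hlift_eqb.
  rewrite expr0 mul1r exprS -mulrA mulrCA.
  by rewrite ['X_(ix j) * _]mulrCA; exact: eqb_uw.
apply: eqb_trans; first by apply: eqb_mulX; apply: mderivw_hlift_low => //; exact: inXY_dw hp.
by rewrite -!scalerAr mulrCA.
Qed.

(** Modulo u w, the part u x_j sees the term k = 0 of the lift and the part y_j d_w sees the term k
    = 1. *)
Lemma actEnT_hlift_high N j (a d e : nat) p : inXY d e p -> (e < N.+2)%N ->
  actE (Sn m) idx_n (idx_T j) (hlift N.+2 a 0 p) =
  hlift N.+2 a.+1 0 (- ('X_(ix j) * p + a.+1%:R^-1 *: ('X_(iy j) * Dxy p))).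
Proof.
move=> hp eN.
have hx : inXY d.+1 e (- ('X_(ix j) * p + a.+1%:R^-1 *: ('X_(iy j) * Dxy p))).
  apply: suppN; apply: suppD; first exact: inXY_mulx.
  apply: suppZ; case: e hp {eN} => [|e] hp.
    by rewrite (inXY_Dxy0 hp) mulr0; exact: supp0.
  by apply: inXY_muly; exact: inXY_Dxy.
apply: (hlift_unique _ hx) => //; first by rewrite muln0.
  by rewrite Delta_actE (Delta_hlift_inXY _ hp) ?linear0 ?muln0.
rewrite actEnT expr0 mulr1 mulrN mulrDr opprD; apply: eqbB.
  apply: eqbN; rewrite -mulrA.
  apply: eqb_trans; first exact/eqb_mulX/eqb_mulX/hlift_eqb.
  by rewrite expr0 mulr1 exprS -mulrA; move=> M _; congr (_@_M); congr (_ * _); rewrite mulrCA.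
apply: eqb_trans.
  by apply: eqb_mulX; apply: mderivw_hlift_high => //; exact: inXY_dw hp.
by move=> M _; congr (_@_M); rewrite -!scalerAr mulrCA.
Qed.

End BoundaryCongruence.

(** * Surjectivity of D' D + c, and moves between boundary values *)

Section Generation.
Variables (K : numFieldType) (m : nat).
Local Notation n := m.+2.
Local Notation V := {mpoly K[m.+2 + m.+2]}.
Implicit Types (f g p : V) (i j : 'I_m.+1) (M : 'X_{1..m.+2 + m.+2}).
Local Notation inXY d e := (supp (bideg d e)).

Lemma Dyx_Dxy f : Dyx (Dxy f) = Dxy (Dyx f) + (Eul_y f - Eul_x f).
Proof. by rewrite Dxy_Dyx -addrA addrA -[Eul_y f - _]opprB addrK. Qed.

(* [W k] consists of the elements of y-degree [k] and total degree [S]; it is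
   zero for [k > S]. *)
Lemma Dxy_Dyx_surj (S k : nat) (c : int) : (k <= S)%N ->
  (forall j : nat, (j <= k)%N ->
     c + (k.+1%:Z - j%:Z) * (S%:Z - k%:Z - j%:Z) != 0) ->
  forall g : V, inXY (S - k) k g ->
    exists2 f, inXY (S - k) k f & Dxy (Dyx f) + c%:~R *: f = g.
Proof.
move=> kS hc g hg.
pose W (k : nat) f := (k <= S)%N /\ inXY (S - k) k f \/ f = 0 :> V.
pose e (k : nat) : K := (S%:Z - k%:Z - k%:Z)%:~R.
have W0 t : W t 0 by right.
have [] := @ladder_bijective K V W (@Dyx K m) (@Dxy K m) e _ _ _ _ _ k c%:~R.
- move=> t a u v [[tS hu]|->] [[tS' hv]|->]; rewrite ?scaler0 ?add0r ?addr0.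
  + by left; split=> //; apply: suppD => //; exact: suppZ.
  + by left; split=> //; exact: suppZ.
  + by left; split.
  + exact: W0.
- move=> t u [[tS hu]|->]; last by rewrite linear0.
  move: tS hu; rewrite leq_eqVlt => /orP[/eqP ->|tS].
    by rewrite subnn => /inXY_Dyx0 h /=; rewrite h.
  by rewrite -subnSK // => hu; left; split=> //; exact: inXY_Dyx.
- move=> t u [[tS hu]|->]; last by rewrite linear0.
  left; split; first exact: ltnW.
  by rewrite -subnSK //; exact: inXY_Dxy.
- by move=> u [[_ hu]|->]; rewrite ?linear0 //; exact: inXY_Dxy0 hu.
- move=> t u [[tS hu]|->]; last by rewrite /= !linear0 addr0.
  rewrite /= Dxy_Dyx (inXY_Eul_x hu) (inXY_Eul_y hu) -scalerBl; congr (_ + _ *: _).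
  by rewrite /e subzn // rmorphB.
- move=> j jk; rewrite /e -rmorph_sum -rmorphD intr_eq0.
  (* Writing S - 2t as (S + 1) - (2t + 1) gives the shape required by [sum_arith]. *)
  rewrite (eq_bigr (fun t : nat => (S%:Z + 1) + (- 1) * (2 * t%:Z + 1))); last first.
    by move=> t _; ring.
  rewrite sum_arith ?leqW //.
  have := hc _ jk; congr (_ + _ * _ != 0).
  by rewrite -[k.+1]addn1 PoszD; ring.
move=> _ /(_ g)[]; first by left.
by move=> f [[_ hf]|->] <-; [exists f | exists 0 => //; exact: supp0].
Qed.

(** Mirror image of [Dxy_Dyx_surj], climbing in the x-degree. The case l_1 + l_2 <= 0 uses the
    former and the case l_1 > 0 this one, each where its partial sums are positive. *)
Lemma Dyx_Dxy_surj (S k : nat) (c : int) : (k <= S)%N ->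
  (forall j : nat, (j <= k)%N ->
     c + (k.+1%:Z - j%:Z) * (S%:Z - k%:Z - j%:Z) != 0) ->
  forall g : V, inXY k (S - k) g ->
    exists2 f, inXY k (S - k) f & Dyx (Dxy f) + c%:~R *: f = g.
Proof.
move=> kS hc g hg.
pose W (k : nat) f := (k <= S)%N /\ inXY k (S - k) f \/ f = 0 :> V.
pose e (k : nat) : K := (S%:Z - k%:Z - k%:Z)%:~R.
have W0 t : W t 0 by right.
have [] := @ladder_bijective K V W (@Dxy K m) (@Dyx K m) e _ _ _ _ _ k c%:~R.
- move=> t a u v [[tS hu]|->] [[tS' hv]|->]; rewrite ?scaler0 ?add0r ?addr0.
  + by left; split=> //; apply: suppD => //; exact: suppZ.
  + by left; split=> //; exact: suppZ.
  + by left; split.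
  + exact: W0.
- move=> t u [[tS hu]|->]; last by rewrite linear0.
  move: tS hu; rewrite leq_eqVlt => /orP[/eqP ->|tS].
    by rewrite subnn => /inXY_Dxy0 h /=; rewrite h.
  by rewrite -subnSK // => hu; left; split=> //; exact: inXY_Dxy.
- move=> t u [[tS hu]|->]; last by rewrite linear0.
  left; split; first exact: ltnW.
  by rewrite -subnSK //; exact: inXY_Dyx.
- by move=> u [[_ hu]|->]; rewrite ?linear0 //; exact: inXY_Dyx0 hu.
- move=> t u [[tS hu]|->]; last by rewrite /= !linear0 addr0.
  rewrite /= Dyx_Dxy (inXY_Eul_x hu) (inXY_Eul_y hu) -scalerBl; congr (_ + _ *: _).
  by rewrite /e subzn // rmorphB.
- move=> j jk; rewrite /e -rmorph_sum -rmorphD intr_eq0.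
  rewrite (eq_bigr (fun t : nat => (S%:Z + 1) + (- 1) * (2 * t%:Z + 1))); last first.
    by move=> t _; ring.
  rewrite sum_arith ?leqW //.
  have := hc _ jk; congr (_ + _ * _ != 0).
  by rewrite -[k.+1]addn1 PoszD; ring.
move=> _ /(_ g)[]; first by left.
by move=> f [[_ hf]|->] <-; [exists f | exists 0 => //; exact: supp0].
Qed.

Variables (N : nat) (SM : V -> Prop).
Hypothesis sSM : submodule (Sn m) SM.

Definition reached a b d e := forall p, inXY d e p -> SM (hlift N.+2 a b p).

Lemma SM0 : SM 0. Proof. by case: sSM. Qed.
Lemma SMD f g : SM f -> SM g -> SM (f + g).
Proof. by case: sSM => _ h _ hf hg; rewrite -[f]scale1r; exact: h. Qed.
Lemma SMZ c f : SM f -> SM (c *: f).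
Proof. by case: sSM => h0 h _ hf; rewrite -[_ *: _]addr0; exact: h. Qed.
Lemma SM_sum (I : Type) (r : seq I) (P : pred I) (F : I -> V) :
  (forall t, P t -> SM (F t)) -> SM (\sum_(t <- r | P t) F t).
Proof. by move=> h; elim/big_ind: _ => //; [exact: SM0 | exact: SMD]. Qed.

Lemma reached_monomials a b d e :
  (forall M, bideg d e M -> SM (hlift N.+2 a b 'X_[M])) -> reached a b d e.
Proof.
move=> h p hp; rewrite [p]mpolyE linear_sum /= big_seq; apply: SM_sum => M.
by rewrite mcoeff_msupp linearZ => /hp /h; exact: SMZ.
Qed.

(** A monomial of y-degree e + 1 is divisible by some y_j, and on lifts with a = 0 the vector
    E_(n,j) just replaces one w by y_j, up to a nonzero factor. *)
Lemma reached_down b d e : (e.+1 < N.+2)%N ->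
  reached 0 b.+1 d e -> reached 0 b d e.+1.
Proof.
move=> eN hr; apply: reached_monomials => M hM.
have [j Mj] : exists j, M (iy j) != 0%N.
  case: (pickP (fun j => M (iy j) != 0%N)) => [j Mj|h]; first by exists j.
  by case: hM => _ _ _; rewrite big1 // => j _; apply/eqP/negPn; rewrite h.
have EM : M = (U_(iy j) + (M - U_(iy j)))%MM by rewrite addmC submK // lep1mP.
have hM' : bideg d e (M - U_(iy j))%MM by apply/(bideg_Uy j); rewrite -EM.
have := hr _ (suppX (K := K) hM').
move/(@submodule_actE _ _ SM idx_n (idx_T j) _ sSM (negbT (idx_n_neq j))).
rewrite (actEnT_hlift_low j b (suppX (K := K) hM') eN) linearN linearZ /=.
move/(SMZ (- b.+1%:R^-1)); rewrite scalerN scaleNr opprK scalerA.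
by rewrite mulVf ?pnatr_eq0 // scale1r -mpolyXD -EM.
Qed.

(* The operators E_(n,j) d_(x_j), summed over j, act on lifts of bidegree
   (d + 1, e) by the operator [Dyx Dxy + (a + 1) (d + 1) - e]. *)
Lemma reached_up a d e : (e < N.+2)%N ->
  (forall g, inXY d.+1 e g -> exists2 f, inXY d.+1 e f &
     Dyx (Dxy f) + ((a.+1 * d.+1)%:R - e%:R) *: f = g) ->
  reached a 0 d e -> reached a.+1 0 d.+1 e.
Proof.
move=> eN surj hr g /surj[f hf <-].
have a0 : a.+1%:R != 0 :> K by rewrite pnatr_eq0.
(* The sum of the x_j d_(x_j) contributes (a + 1)(d + 1), and commuting d_(x_j) with D contributes
   -e. *)
suff -> : Dyx (Dxy f) + ((a.+1 * d.+1)%:R - e%:R) *: f =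
    - a.+1%:R *: \sum_j (- ('X_(ix j) * mderiv (ix j) f +
        a.+1%:R^-1 *: ('X_(iy j) * Dxy (mderiv (ix j) f)))).
  rewrite linearZ; apply: SMZ; rewrite (linear_sum (@hlift K m N.+2 a.+1 0)); apply: SM_sum => j _ /=.
  rewrite -(actEnT_hlift_high j a (inXY_dx hf) eN).
  apply: submodule_actE => //; first by rewrite idx_n_neq.
  exact/hr/inXY_dx.
rewrite sumrN scalerN scaleNr opprK big_split /= -/(Eul_x f) (inXY_Eul_x hf).
rewrite -scaler_sumr scalerDr !scalerA divff // scale1r -natrM.
have -> : \sum_j 'X_(iy j) * Dxy (mderiv (ix j) f) = Dyx (Dxy f) - Eul_y f.
  rewrite /Dyx /Eul_y -sumrB; apply: eq_bigr => j _.
  by rewrite mderiv_DxyE mulrDr addrK.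
by rewrite (inXY_Eul_y hf) scalerBl addrCA addrA.
Qed.

(* The operators E_(s,j) move a monomial in the variables [F j] step by step
   from the power of [F s] to any other one. *)
Lemma reached_transfer (F : 'I_m.+1 -> 'I_(n + n)) (P Q : 'X_{1..n + n} -> Prop)
    (D : nat) : injective F ->
  (forall M, P M -> (\sum_j M (F j) = D)%N) ->
  (forall M, P M -> M (F ord_max) = D -> Q M) ->
  (forall M j, P M -> j != ord_max -> M (F j) != 0%N ->
     P (U_(F ord_max) + (M - U_(F j)))%MM) ->
  (forall M j, P M -> j != ord_max -> M (F j) != 0%N ->
     Q (U_(F ord_max) + (M - U_(F j)))%MM -> Q M) ->
  forall M, P M -> Q M.
Proof.
move=> Finj hD h0 hP hQ M; move: {2}(D - M _)%N (erefl (D - M (F ord_max))%N) => k.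
elim: k M => [|k IH] M hk PM.
  have le : (M (F ord_max) <= D)%N by rewrite -(hD _ PM) (bigD1 ord_max) //= leq_addr.
  by apply: h0 => //; apply/eqP; rewrite eqn_leq le -subn_eq0 hk.
have [j /andP[jm Mj]] : exists j, (j != ord_max) && (M (F j) != 0%N).
  case: (pickP (fun j => (j != ord_max) && (M (F j) != 0%N))) => [j Mj|h].
    by exists j.
  have := hD _ PM; rewrite (bigD1 ord_max) //= big1 => [e|j jm].
    by move: hk; rewrite -e addn0 subnn.
  by apply/eqP/negPn; move: (h j); rewrite jm /= => ->.
apply: (hQ M j) => //; apply: IH; last exact: hP.
rewrite mnmDE mnmBE !mnm1E eqxx (inj_eq Finj) (negbTE jm) subn0 add1n.
by rewrite subnS hk.
Qed.

End Generation.

(** * The highest weight vectors and the modules they generate *)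

Section HighestWeightVectors.
Variables (K : numFieldType) (m : nat).
Local Notation n := m.+2.
Local Notation V := {mpoly K[m.+2 + m.+2]}.
Implicit Types (f g p : V) (i j : 'I_m.+1) (M : 'X_{1..m.+2 + m.+2}).
Local Notation inXY d e := (supp (bideg d e)).
Local Notation smax := (@ord_max m).

Lemma mulX_mderivX s t M :
  'X_s * mderiv t ('X_[M] : V) = (M t)%:R *: 'X_[U_(s) + (M - U_(t))].
Proof. by rewrite mderivX -scalerAr -mpolyXD. Qed.

Lemma bideg_x d : bideg d 0 (U_(ix smax) *+ d)%MM.
Proof.
rewrite /bideg !mulmnE !mnm1E !var_eqE !mul0n; split=> //.
  under eq_bigr do rewrite mulmnE; rewrite -big_distrl /= sum_mnm1 ?mul1n //.
  exact: ix_inj.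
by rewrite big1 // => i _; rewrite mulmnE mnm1E var_eqE mul0n.
Qed.

Lemma bideg_y e : bideg 0 e (U_(iy smax) *+ e)%MM.
Proof.
rewrite /bideg !mulmnE !mnm1E !var_eqE !mul0n; split=> //.
  by rewrite big1 // => i _; rewrite mulmnE mnm1E var_eqE mul0n.
under eq_bigr do rewrite mulmnE; rewrite -big_distrl /= sum_mnm1 ?mul1n //.
exact: iy_inj.
Qed.

Lemma inXY_xs d : inXY d 0 ('X_(ix smax) ^+ d : V).
Proof. by rewrite mpolyXn; apply: suppX; exact: bideg_x. Qed.

Lemma inXY_ys e : inXY 0 e ('X_(iy smax) ^+ e : V).
Proof. by rewrite mpolyXn; apply: suppX; exact: bideg_y. Qed.

Lemma low_vector_hlift N d b : (0 < N)%N ->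
  hlift N 0 b ('X_(ix smax) ^+ d : V) = xv K idx_s ^+ d * yv K idx_n ^+ b.
Proof.
move=> N0; rewrite (@hlift_change _ _ N 1 0 b d 0) //; last exact: inXY_xs.
rewrite /hlift big_ord1 /hlift_coef !addn0 divff ?scale1r.
  by rewrite expr0 mul1r mulrC.
by rewrite pnatr_eq0 -lt0n muln_gt0 !fact_gt0.
Qed.

Lemma low_monomial (l1 : int) l2 :
  'X_[low_mnm m l1 l2] = xv K idx_s ^+ `|- l1|%N * yv K idx_n ^+ l2.
Proof.
have -> : xv K idx_s = 'X_(ix smax) by [].
have -> : yv K idx_n = 'X_iw :> V by [].
rewrite !mpolyXn -mpolyXD; congr 'X_[_]; apply: mnm_varP => [i||i|];
  rewrite mjoinE mnmDE !mulmnE !mnm1E !var_eqE ?eqxx.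
- by rewrite mul0n addn0.
- by rewrite idx_T_neq !mul0n.
- by rewrite idx_n_neq !mul0n.
- by rewrite mul0n.
Qed.

Lemma iter_Dxy_ys e k : (k <= e)%N ->
  iter k (@Dxy K m) ('X_(iy smax) ^+ e) =
  (e ^_ k)%:R *: ('X_(ix smax) ^+ k * 'X_(iy smax) ^+ (e - k)).
Proof.
elim: k => [|k IH] ke; first by rewrite ffactn0 scale1r expr0 mul1r subn0.
rewrite iterS IH ?(ltnW ke) // linearZ /= Dxy_mulXn_x Dxy_Xn_y -scalerAr scalerA.
by rewrite -natrM -ffactnSr mulrA -exprSr subnS.
Qed.

(** The vector is the lift of u^(l_1) y_s^(l_2); the factor (l_2 - t)! in its denominators comes
    from the falling factorial in [iter_Dxy_ys]. *)
Lemma hwv_pos_hlift N l1 l2 : (l2 < N)%N ->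
  hwv_pos K m l1 l2 = hlift N l1 0 ('X_(iy smax) ^+ l2).
Proof.
move=> lN; rewrite (@hlift_change _ _ N l2.+1 l1 0 0 l2) ?muln0 //;
  last exact: inXY_ys.
apply: eq_bigr => t _; have tl : (t <= l2)%N by rewrite -ltnS.
rewrite iter_Dxy_ys // -scalerAr scalerA add0n; congr (_ *: _).
  have ffl : ((l2 ^_ t)%:R : K) = l2`!%:R / (l2 - t)`!%:R.
    by rewrite -(ffact_fact tl) natrM mulfK // pnatr_eq0 -lt0n fact_gt0.
  rewrite /hlift_coef ffl add0n fact0 muln1 !natrM.
  have fn0 (k : nat) : (k`!%:R : K) != 0 by rewrite pnatr_eq0 -lt0n fact_gt0.
  by field; rewrite !fn0.
rewrite -/(ix smax) -/(iu) -/(iy smax) -/(iw).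
have -> : xv K idx_s = 'X_(ix smax) by [].
have -> : xv K idx_n = 'X_iu :> V by [].
have -> : yv K idx_s = 'X_(iy smax) by [].
have -> : yv K idx_n = 'X_iw :> V by [].
move: (_ ^+ t) (_ ^+ (l1 + t)) (_ ^+ (l2 - t)) (_ ^+ t) => *; ring.
Qed.

Lemma basis_poly_high (l1 : int) l2 :
  basis_poly K (high_x m l1) (high_y m l2) = hwv_pos K m `|l1| l2.
Proof.
have ex : xyT K (high_x m l1) (high_y m l2) = 'X_(iy smax) ^+ l2.
  rewrite xyT_monomial mpolyXn; congr 'X_[_]; apply: mnm_varP => [i||i|];
    rewrite mjoinE ?mnmTT ?mnmTn !mulmnE !mnm1E ?var_eqE ?mul0n //.
  by rewrite idx_n_neq.
rewrite basis_polyE ex (@hwv_pos_hlift (bnd (high_y m l2))).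
  by rewrite !mulmnE !mnm1E eqxx mul1n idx_T_neq mul0n.
by rewrite ltnS mdegMn mdeg1 mul1n mulSn leq_addr.
Qed.

Section Generation.
Variables (l1 : int) (l2 : nat) (SM : V -> Prop).
Hypothesis sSM : submodule (Sn m) SM.
Local Notation reached := (reached l2 SM).

(** Without y_i the operator E_(s,j) reduces to - x_j d_(x_s), so it sends the lift of x_s M / x_j
    to a nonzero multiple of the lift of M. *)
Lemma reached_bottom_low d : SM (xv K idx_s ^+ d * yv K idx_n ^+ l2) ->
  reached 0 l2 d 0.
Proof.
rewrite -(@low_vector_hlift l2.+2) // => hv; apply: reached_monomials => //.
apply: (@reached_transfer m (@ix m) (bideg d 0) _ d).
- exact: ix_inj.
- by move=> M [].
- move=> M [Mu Mw sx sy] Md; suff -> : M = (U_(ix smax) *+ d)%MM by rewrite -mpolyXn.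
  apply: mnm_varP => [i||i|]; rewrite mulmnE mnm1E !var_eqE ?mul0n //.
    have [<-|im] := eqVneq; first by rewrite mul1n.
    move: sx; rewrite (bigD1 smax) //= Md -{2}[d]addn0 => /addnI/eqP.
    by rewrite sum_nat_eq0 => /forallP/(_ i); rewrite eq_sym im => /eqP ->.
  exact: sum_nat0 sy.
- move=> M j hM jm Mj; case: d {hv} hM => [|d] hM.
    by case: hM => _ _ /(@sum_nat0 _ _ j) h; rewrite h in Mj.
  by apply/bideg_Ux/(bideg_Ux j); rewrite addmC submK // lep1mP.
move=> M j hM jm Mj.
have hM' : bideg d 0 (U_(ix smax) + (M - U_(ix j)))%MM.
  case: d {hv} hM => [|d] hM.
    by case: hM => _ _ /(@sum_nat0 _ _ j) h; rewrite h in Mj.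
  by apply/bideg_Ux/(bideg_Ux j); rewrite addmC submK // lep1mP.
have ne : idx_T smax != idx_T j by rewrite idx_T_eq eq_sym.
move/(@submodule_actE _ _ SM _ _ _ sSM ne).
rewrite (actETT_hlift smax j _ (suppX (K := K) hM')) //.
rewrite actETT !mulX_mderivX eq_sym (negbTE jm) mul0r subr0.
have -> : (U_(ix smax) + (M - U_(ix j)))%MM (iy smax) = 0%N.
  by case: hM' => _ _ _ /(@sum_nat0 _ _ smax).
have -> : (U_(ix j) + (U_(ix smax) + (M - U_(ix j)) - U_(ix smax)))%MM = M.
  rewrite [(U_(ix smax) + _)%MM]addmC addmK addmC submK // lep1mP //.
rewrite scale0r subr0 -scaleNr linearZ /=.
set c : K := - _; have c0 : c != 0.
  by rewrite oppr_eq0 pnatr_eq0 mnmDE mnm1E eqxx.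
by move/(SMZ sSM c^-1); rewrite scalerA mulVf // scale1r.
Qed.

(** Without x_i the operator E_(s,j) reduces on the boundary to - y_j d_(y_s), which serves in the
    same way. *)
Lemma reached_bottom_high (a : nat) : SM (hwv_pos K m a l2) ->
  reached a 0 0 l2.
Proof.
rewrite (@hwv_pos_hlift l2.+2) // => hv; apply: reached_monomials => //.
apply: (@reached_transfer m (@iy m) (bideg 0 l2) _ l2).
- exact: iy_inj.
- by move=> M [].
- move=> M [Mu Mw sx sy] Md; suff -> : M = (U_(iy smax) *+ l2)%MM by rewrite -mpolyXn.
  apply: mnm_varP => [i||i|]; rewrite mulmnE mnm1E !var_eqE ?mul0n //.
    exact: sum_nat0 sx.
  have [<-|im] := eqVneq; first by rewrite mul1n.
  move: sy; rewrite (bigD1 smax) //= Md -{2}[l2]addn0 => /addnI/eqP.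
  by rewrite sum_nat_eq0 => /forallP/(_ i); rewrite eq_sym im => /eqP ->.
- move=> M j hM jm Mj; case: l2 {hv} hM => [|l] hM.
    by case: hM => _ _ _ /(@sum_nat0 _ _ j) h; rewrite h in Mj.
  by apply/bideg_Uy/(bideg_Uy j); rewrite addmC submK // lep1mP.
move=> M j hM jm Mj.
have hM' : bideg 0 l2 (U_(iy smax) + (M - U_(iy j)))%MM.
  case: l2 {hv} hM => [|l] hM.
    by case: hM => _ _ _ /(@sum_nat0 _ _ j) h; rewrite h in Mj.
  by apply/bideg_Uy/(bideg_Uy j); rewrite addmC submK // lep1mP.
have ne : idx_T smax != idx_T j by rewrite idx_T_eq eq_sym.
move/(@submodule_actE _ _ SM _ _ _ sSM ne).
rewrite (actETT_hlift smax j _ (suppX (K := K) hM')) ?muln0 //.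
rewrite actETT !mulX_mderivX eq_sym (negbTE jm) mul0r subr0.
have -> : (U_(iy smax) + (M - U_(iy j)))%MM (ix smax) = 0%N.
  by case: hM' => _ _ /(@sum_nat0 _ _ smax).
have -> : (U_(iy j) + (U_(iy smax) + (M - U_(iy j)) - U_(iy smax)))%MM = M.
  rewrite [(U_(iy smax) + _)%MM]addmC addmK addmC submK // lep1mP //.
rewrite scale0r oppr0 sub0r -scaleNr linearZ /=.
set c : K := - _; have c0 : c != 0.
  by rewrite oppr_eq0 pnatr_eq0 mnmDE mnm1E eqxx.
by move/(SMZ sSM c^-1); rewrite scalerA mulVf // scale1r.
Qed.

Lemma reached_Hsp :
  (forall a b d e : nat, (a * b = 0)%N -> a%:Z - d%:Z = l1 -> (b + e = l2)%N ->
     reached a b d e) ->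
  forall f, Hsp l1 l2 f -> SM f.
Proof.
move=> h f hf; rewrite (Hsp_expansion hf) big_seq_cond.
have /HspP[[h1 h2] _] := hf.
apply: (SM_sum sSM) => M /andP[]; rewrite mcoeff_msupp => hM /eqP M0.
apply: (SMZ sSM); have [/= i0 i1 i2] := basis_index_mnm (h1 _ hM) (h2 _ hM) M0.
set a := mnml M in i0 i1 *; set b := mnmr M in i0 i2 *.
have e2 : (b idx_n + \sum_i b (idx_T i) = l2)%N by rewrite -i2 sum_idx addnC.
have hp := @inXY_xyT K m a b.
rewrite basis_polyE (@hlift_change _ _ _ l2.+2 _ _ _ _ _ i0 hp).
- apply: (h _ _ _ _ i0 _ e2 _ hp).
  by rewrite -i1 (big_morph Posz PoszD (erefl _)).
- by rewrite ltnS mdegE sum_idx mulSn -addnA; exact: leq_addr.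
- by rewrite -e2 -addnS -addnS; apply: leq_trans (leq_addl _ _); rewrite ltnS leqnSn.
Qed.

Lemma low_generates : l1 + l2%:Z <= 0 ->
  SM (xv K idx_s ^+ `|- l1|%N * yv K idx_n ^+ l2) -> forall f, Hsp l1 l2 f -> SM f.
Proof.
move=> hl /reached_bottom_low h0.
(* The boundary values free of u: every step trades a factor w for some y_j. *)
have h1 k : (k <= l2)%N -> reached 0 (l2 - k) `|- l1| k.
  elim: k => [|k IH] kl; first by rewrite subn0.
  apply: (reached_down sSM); first by rewrite ltnS ltnW.
  by rewrite subnSK //; exact/IH/ltnW.
(* Those free of w: every step raises the exponent of u and the x-degree together. *)
have h2 a : reached a 0 (`|- l1| + a) l2.
  elim: a => [|a IH]; first by have := h1 _ (leqnn _); rewrite subnn addn0.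
  rewrite addnS; apply: (reached_up sSM) => //.
  set d := (`|- l1| + a)%N => g hg.
  (* Replacing D' D by D D' + l_2 - (d + 1) turns the constant (a + 1)(d + 1) - l_2 into a (d + 1).
     The sums a (d + 1) + (l_2 + 1 - j)(d + 1 - j) are positive since j <= l_2 <= -l_1 <= d. *)
  have [j jl||f] := @Dxy_Dyx_surj K m (d.+1 + l2) l2 (a * d.+1)%N (leq_addl _ _) _ g.
  - have : (0 : int) < (l2.+1%:Z - j%:Z) * ((d.+1 + l2)%N%:Z - l2%:Z - j%:Z).
      by apply: mulr_gt0; lia.
    by lia.
  - by rewrite addnK.
  rewrite addnK => hf <-; exists f => //.
  rewrite Dyx_Dxy (inXY_Eul_y hf) (inXY_Eul_x hf) -scalerBl -addrA -scalerDl.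
  congr (_ + _ *: _); rewrite mulSn natrD -pmulrn; ring.
apply: reached_Hsp => a b d e /eqP; rewrite muln_eq0 => /orP[]/eqP -> hd he.
  have -> : d = `|- l1|%N by lia.
  have -> : b = (l2 - e)%N by lia.
  by apply: h1; lia.
have -> : d = (`|- l1| + a)%N by lia.
by have -> : e = l2 by []; exact: h2.
Qed.

Lemma high_generates : 0 < l1 ->
  SM (hwv_pos K m `|l1| l2) -> forall f, Hsp l1 l2 f -> SM f.
Proof.
move=> hl /reached_bottom_high h0.
have h2 k : reached (`|l1| + k) 0 k l2.
  elim: k => [|d IH]; first by rewrite addn0.
  rewrite addnS; apply: (reached_up sSM) => //.
  set a := (`|l1| + d)%N => g hg.
  have [j jl||f] := @Dyx_Dxy_surj K m (d.+1 + l2) d.+1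
    ((a.+1 * d.+1)%N%:Z - l2%:Z) (leq_addr _ _) _ g.
  (* The sum is (a + 1)(d + 1) - l_2 + (d + 2 - j)(l_2 - j). As a >= d + 1, the first product is at
     least (d + 2)(d + 1) and outweighs j (d + 2 - j); and (d + 2 - j) l_2 >= l_2 because j <= d +
     1. *)
  - have t0 : (j * (d.+2 - j) < d.+2 * d.+1)%N by nia.
    suff : (0 : int) < (a.+1 * d.+1)%N%:Z - l2%:Z +
       (d.+2%:Z - j%:Z) * ((d.+1 + l2)%N%:Z - d.+1%:Z - j%:Z) by lia.
    have a1 : (d.+2 * d.+1 <= a.+1 * d.+1)%N by rewrite leq_mul2r; lia.
    have : (0 : int) <= (d.+1%:Z - j%:Z) * l2%:Z by apply: mulr_ge0; lia.
    by nia.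
  - by rewrite addKn.
  rewrite addKn => hf <-; exists f => //.
  by rewrite rmorphB.
apply: reached_Hsp => a b d e /eqP ab hd he.
have -> : a = (`|l1| + d)%N by lia.
have b0 : b = 0%N by move: ab; rewrite muln_eq0 => /orP[]/eqP //; lia.
have -> : e = l2 by rewrite -he b0.
by rewrite b0; exact: h2.
Qed.

End Generation.

End HighestWeightVectors.

(** * Weights of the highest weight vectors *)

Section Weights.
Variables (K : numFieldType) (m : nat).
Local Notation n := m.+2.
Local Notation V := {mpoly K[m.+2 + m.+2]}.
Implicit Types (v : V) (i : 'I_m.+1) (A : 'M[K]_m.+2).

Lemma cartan_diag A : cartan A -> (forall k l, k != l -> A k l = 0) /\ \tr A = 0.
Proof.
case=> s [hs ->]; rewrite big_seq; split=> [k l kl|].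
  rewrite summxE big1 // => cu /hs[[i j] _ ->]; rewrite !mxE.
  have dd (t : 'I_n) : (k == t) && (l == t) = false.
    by apply/andP => -[/eqP e /eqP e']; move: kl; rewrite e e' eqxx.
  by rewrite !dd subrr mulr0.
rewrite raddf_sum big1 // => cu /hs[[i j] _ ->] /=.
have trd (t : 'I_n) : \tr (delta_mx t t : 'M[K]_n) = 1.
  rewrite /mxtrace (bigD1 t) //= mxE !eqxx big1 ?addr0 // => k kt.
  by rewrite mxE (negbTE kt).
by rewrite mxtraceZ raddfB /= !trd subrr mulr0.
Qed.

(** E_(i,i) with i in T multiplies a monomial by -(1 + the exponents of x_i and y_i), and E_(n,n) by
    the exponent of u minus that of w. Both highest weight vectors have these constant, with [t]
    located at i = s. *)
Definition weight_supp (t : nat) (z : int) (M : 'X_{1..n + n}) : Prop :=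
  (forall i, M (ix i) + M (iy i) = (i == ord_max) * t)%N /\
  (M iu)%:Z - (M iw)%:Z = z.

Lemma actE_diag t z v : supp (weight_supp t z) v ->
  (forall i, actE (Sn m) (idx_T i) (idx_T i) v =
     - (((i == ord_max) * t).+1)%:R *: v) /\
  actE (Sn m) idx_n idx_n v = z%:~R *: v.
Proof.
move=> h; split=> [i|]; apply/mpolyP => M; rewrite actEE mcoeffZ.
  rewrite eqxx mul1r !mcoeffB mcoeffN !mcoeff_mulX_mderiv.
  have [->|/h[/(_ i) <- _]] := eqVneq v@_M 0; first by rewrite !mulr0 !subr0 oppr0.
  by rewrite -natr1 natrD; ring.
rewrite mcoeffB !mcoeff_mulX_mderiv.
have [->|/h[_ <-]] := eqVneq v@_M 0; first by rewrite !mulr0 subr0.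
by rewrite rmorphB /= mulrBl.
Qed.

Lemma fund_weight_S A : fund_weight m.+1 A = \sum_i A (idx_T i) (idx_T i).
Proof.
rewrite /fund_weight big_mkcond sum_idx /= ltnn addr0.
by apply: eq_bigr => i _; rewrite ltn_ord.
Qed.

Lemma fund_weight_m A :
  fund_weight m A = fund_weight m.+1 A - A idx_s idx_s.
Proof.
rewrite fund_weight_S (bigD1 ord_max) //= addrC addrK.
rewrite /fund_weight big_mkcond sum_idx /= ltnNge leqnSn addr0 [RHS]big_mkcond.
apply: eq_bigr => i _ /=; rewrite -val_eqE /= ltn_neqAle.
by rewrite -ltnS ltn_ord andbT.
Qed.

(** The constants -1 over T add up to -lambda_(n-1), the s-th entry contributes -t (lambda_(n-1) -
    lambda_(n-2)), and trace zero turns z A_(n,n) into -z lambda_(n-1). *)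
Lemma has_weight_supp t z v : supp (weight_supp t z) v ->
  has_weight (Sn m) v (fun A => t%:R * fund_weight m A
    - (z + t%:Z + 1)%:~R * fund_weight m.+1 A).
Proof.
move=> h A /cartan_diag[Aoff trA]; have [hT hn] := actE_diag h.
have -> : act (Sn m) A v = \sum_k A k k *: actE (Sn m) k k v.
  apply: eq_bigr => k _; rewrite (bigD1 k) //= big1 ?addr0 // => l lk.
  by rewrite Aoff ?scale0r // eq_sym.
rewrite sum_idx hn scalerA; under eq_bigr do rewrite hT scalerA.
rewrite -scaler_suml -scalerDl; congr (_ *: _).
have An : A idx_n idx_n = - fund_weight m.+1 A.
  move: trA; rewrite /mxtrace sum_idx -fund_weight_S addrC => /eqP.
  by rewrite addr_eq0 => /eqP.
rewrite An fund_weight_m fund_weight_S.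
rewrite [in X in X + _](bigD1 ord_max) //= eqxx mul1n.
rewrite (eq_bigr (fun i => - A (idx_T i) (idx_T i))) => [|i /negbTE ->]; last first.
  by rewrite mul0n mulrN mulr1.
rewrite sumrN [\sum_i A (idx_T i) (idx_T i)](bigD1 ord_max) //=.
set B := \sum_(i | _) _; rewrite -natr1 !rmorphD /= -pmulrn -/idx_s.
by ring.
Qed.

End Weights.

(** * Irreducibility from uniqueness and generation *)

Section HarmonicModule.
Variables (K : numFieldType) (m : nat) (l1 : int) (l2 : nat).
Variables (v : {mpoly K[m.+2 + m.+2]}).
Hypothesis Hv : Hsp l1 l2 v.
Hypothesis v0 : v != 0.
Hypothesis v_unique : forall f, Hsp l1 l2 f -> singular f ->
  exists c, f = c *: v.
Hypothesis v_gen : forall N, submodule (Sn m) N -> N v ->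
  forall f, Hsp l1 l2 f -> N f.

Lemma submodule_v (N : {mpoly K[m.+2 + m.+2]} -> Prop) f : submodule (Sn m) N ->
  (forall g, N g -> Hsp l1 l2 g) -> N f -> f != 0 -> N v /\ singular v.
Proof.
move=> sN NH Nf f0; have [g [Ng g0 sg]] := submodule_singular sN Nf f0.
have [c e] := v_unique (NH _ Ng) sg.
have c0 : c != 0 by apply: contra_neq g0 => c0; rewrite e c0 scale0r.
have -> : v = c^-1 *: g by rewrite e scalerA mulVf // scale1r.
split; first exact: (SMZ sN).
by move=> a b ab; rewrite linearZ /= sg // scaler0.
Qed.

Lemma harmonic_irreducible : irreducible_module (Sn m) (@Hsp K m l1 l2).
Proof.
split; first exact: Hsp_submodule.
  by exists v => //; apply/eqP.
(* The submodule is an arbitrary predicate, so this dichotomy is classical. *)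
move=> N sN NH; have [[f [Nf f0]]|h] := boolp.EM (exists f, N f /\ f != 0).
  by right; apply: v_gen => //; have [] := submodule_v sN NH Nf f0.
by left=> f Nf; apply/eqP/negPn/negP => f0; apply: h; exists f.
Qed.

(** That [v] is singular takes no computation: the whole module contains a nonzero singular vector,
    which by uniqueness is a multiple of [v]. *)
Lemma harmonic_highest_weight mu : has_weight (Sn m) v mu ->
  highest_weight_module_of (Sn m) (@Hsp K m l1 l2) mu v.
Proof.
move=> hmu; have sH := Hsp_submodule K m l1 l2.
have [_ sv] := submodule_v sH (fun _ => id) Hv v0.
split=> //; split; first by apply/eqP.
  by move=> A hA; exists (mu A); exact: hmu.
by move=> a b ab; rewrite act_delta sv.
Qed.

End HarmonicModule.

Lemma highest_weight_module_of_module (K : fieldType) n (S : {set 'I_n}) M mu v :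
  @highest_weight_module_of K n S M mu v -> highest_weight_module S M.
Proof. by case=> sM hv gv _; split=> //; exists v. Qed.

(** * The cases l_1 + l_2 <= 0 and l_1 > 0 *)

Section Cases.
Variables (K : numFieldType) (m : nat) (l1 : int) (l2 : nat).

Local Notation low := (xv K idx_s ^+ `|- l1|%N * yv K idx_n ^+ l2
  : {mpoly K[m.+2 + m.+2]}).
Local Notation high := (hwv_pos K m `|l1| l2).

Lemma low_Hsp : l1 + l2%:Z <= 0 -> Hsp l1 l2 low.
Proof.
move=> hl; rewrite -(@low_vector_hlift K m 1) //.
apply: (Hsp_hlift _ (@inXY_xs K m _)); rewrite ?mul0n ?addn0 //.
by lia.
Qed.

Lemma high_Hsp : 0 < l1 -> Hsp l1 l2 high.
Proof.
move=> hl; rewrite -basis_poly_high.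
exact: (basis_poly_Hsp K (basis_index_high m l2 hl)).
Qed.

Lemma low_neq0 : low != 0.
Proof.
rewrite -low_monomial; apply/eqP => /(congr1 (mcoeff (low_mnm m l1 l2))).
by move/eqP; rewrite mcoeffX eqxx mcoeff0 oner_eq0.
Qed.

Lemma high_neq0 : high != 0.
Proof.
rewrite -basis_poly_high; apply/eqP.
move/(congr1 (mcoeff (mjoin (high_x m l1) (high_y m l2)))).
move/eqP; rewrite basis_poly_boundary ?eqxx ?mcoeff0 ?oner_eq0 //.
by rewrite !mjoinE !mulmnE !mnm1E idx_T_neq mul0n muln0.
Qed.

Lemma low_weight : l1 + l2%:Z <= 0 -> has_weight (Sn m) low
  (fun A => (- l1)%:~R * fund_weight m A
            + (l1 + l2%:Z - 1)%:~R * fund_weight m.+1 A).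
Proof.
move=> hl A hA; rewrite (@has_weight_supp K m `|- l1| (- l2%:Z) low _ A hA).
  rewrite pmulrn; have -> : (`|- l1|%N : int) = - l1 by lia.
  congr (_ *: _); congr (_ + _); rewrite -mulNr -rmorphN; congr (_%:~R * _); ring.
rewrite -low_monomial; apply: suppX; split=> [i|].
  by rewrite !mjoinE !mulmnE !mnm1E idx_n_neq mul0n addn0 idx_T_eq eq_sym.
by rewrite !mjoinE !mulmnE !mnm1E idx_T_neq eqxx mul0n mul1n sub0r.
Qed.

Lemma high_weight : 0 < l1 -> has_weight (Sn m) high
  (fun A => l2%:R * fund_weight m A
            - (l1 + l2%:Z + 1)%:~R * fund_weight m.+1 A).
Proof.
move=> hl; apply: has_weight_supp; apply: supp_sum => t _; apply: suppZ.
have tl : (t <= l2)%N by rewrite -ltnS.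
have -> : xv K idx_s = 'X_(ix ord_max) by [].
have -> : xv K idx_n = 'X_iu :> {mpoly K[m.+2 + m.+2]} by [].
have -> : yv K idx_s = 'X_(iy ord_max) by [].
have -> : yv K idx_n = 'X_iw :> {mpoly K[m.+2 + m.+2]} by [].
rewrite !mpolyXn -!mpolyXD; apply: suppX; split=> [i|].
  rewrite !mnmDE !mulmnE !mnm1E !var_eqE !mul0n !addn0 !add0n eq_sym -mulnDr.
  by rewrite subnKC.
rewrite !mnmDE !mulmnE !mnm1E !var_eqE !eqxx !mul0n !mul1n !addn0 !add0n.
by rewrite PoszD addrK gtz0_abs.
Qed.

Lemma low_unique f : l1 + l2%:Z <= 0 -> Hsp l1 l2 f -> singular f ->
  exists c, f = c *: low.
Proof.
move=> hl hf sf; exists f@_(low_mnm m l1 l2).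
by rewrite -low_monomial; exact: singular_low.
Qed.

Lemma high_unique f : 0 < l1 -> Hsp l1 l2 f -> singular f ->
  exists c, f = c *: high.
Proof.
move=> hl hf sf; exists f@_(mjoin (high_x m l1) (high_y m l2)).
by rewrite -basis_poly_high; exact: singular_high.
Qed.

End Cases.

Theorem theorem5p4 (R : realType) (m : nat) (l1 : int) (l2 : nat)
    (hl : l1 + l2%:Z <= 0 \/ 0 < l1) :
  let H : {mpoly R[i][m.+2 + m.+2]} -> Prop := @Hsp R[i] m l1 l2 in
  direct_sum (@Bsp R[i] m.+2 (Sn m) l1 l2%:Z) H
    (@etaB R[i] m (l1 - 1) (l2%:Z - 1))
  /\ irreducible_module (Sn m) H
  /\ highest_weight_module (Sn m) H
  /\ (l1 + l2%:Z <= 0 ->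
      highest_weight_module_of (Sn m) H
        (fun A => (- l1)%:~R * fund_weight m A
                  + (l1 + l2%:Z - 1)%:~R * fund_weight m.+1 A)
        (xv R[i] idx_s ^+ `|- l1|%N * yv R[i] idx_n ^+ l2))
  /\ (0 < l1 ->
      highest_weight_module_of (Sn m) H
        (fun A => l2%:R * fund_weight m A
                  - (l1 + l2%:Z + 1)%:~R * fund_weight m.+1 A)
        (hwv_pos R[i] m `|l1|%N l2))
  /\ basis_of_family (basis_index l1 l2)
       (fun ab => basis_poly R[i] ab.1 ab.2) H.
Proof.
move=> H.
have low_case : l1 + l2%:Z <= 0 -> irreducible_module (Sn m) H /\
    highest_weight_module_of (Sn m) H
        (fun A => (- l1)%:~R * fund_weight m A
                  + (l1 + l2%:Z - 1)%:~R * fund_weight m.+1 A)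
        (xv R[i] idx_s ^+ `|- l1|%N * yv R[i] idx_n ^+ l2).
  move=> h; split.
    apply: (harmonic_irreducible (low_Hsp _ _ h) (low_neq0 _ _ _ _)).
      by move=> f; exact: low_unique.
    by move=> N sN Nv; exact: low_generates.
  apply: (harmonic_highest_weight (low_Hsp _ _ h) (low_neq0 _ _ _ _)).
  - by move=> f; exact: low_unique.
  - by move=> N sN Nv; exact: low_generates.
  exact: low_weight.
have high_case : 0 < l1 -> irreducible_module (Sn m) H /\
    highest_weight_module_of (Sn m) H
        (fun A => l2%:R * fund_weight m A
                  - (l1 + l2%:Z + 1)%:~R * fund_weight m.+1 A)
        (hwv_pos R[i] m `|l1|%N l2).
  move=> h; split.
    apply: (harmonic_irreducible (high_Hsp _ _ _ h) (high_neq0 _ _ _ _)).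
      by move=> f; exact: high_unique.
    by move=> N sN Nv; exact: high_generates.
  apply: (harmonic_highest_weight (high_Hsp _ _ _ h) (high_neq0 _ _ _ _)).
  - by move=> f; exact: high_unique.
  - by move=> N sN Nv; exact: high_generates.
  exact: high_weight.
split; first exact: Hsp_decomposition.
split; first by case: hl => [/low_case[]|/high_case[]].
split.
  by case: hl => [/low_case[_ h]|/high_case[_ h]];
     exact: highest_weight_module_of_module h.
split; first by move=> /low_case[].
split; first by move=> /high_case[].
exact: Hsp_basis.
Qed.
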